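(* Let $1\le p<\infty$ and let $(X,\rho)$ be a sequentially complete semi-normed space. Then $L^p_\rho([a,b];X)$ is a closed subspace of $\mathcal{U}^p_\rho([a,b];X)$.
   Context: $[a,b]$ is a compact interval and $(X,\rho)$ is a real vector space with a semi-norm $\rho$; it is sequentially complete if every sequence that is Cauchy for the pseudo-metric $\rho(u-v)$ converges for it to some element of $X$. A gauge on $[a,b]$ is a function $\delta:[a,b]\to(0,\infty)$. A tagged partition of $[a,b]$ is a finite collection $D=\{([u_i,v_i],t_i):1\le i\le n\}$ of non-overlapping non-degenerate closed intervals with union $[a,b]$ and tags $t_i\in[u_i,v_i]$; it is $\delta$-fine if $[u_i,v_i]\subseteq(t_i-\delta(t_i),t_i+\delta(t_i))$ for every $i$. For such $D$, $(D)\sum$ denotes summation over the members $([u,v],t)$ of $D$. For $f:[a,b]\to X$ and $1\le p<\infty$, $$\mu^p_\rho(f,[a,b])=\inf_{\text{gauge }\delta}\ \sup\Big\{(D)\sum \rho(f(t))^p\,(v-u): D\text{ is a }\delta\text{-fine tagged partition of }[a,b]\Big\}\in[0,\infty].$$ $\mathcal{U}^p_\rho([a,b];X)$ is the set of all $f:[a,b]\to X$ with $\mu^p_\rho(f,[a,b])<\infty$, with the topology given by the semi-norm $\|f\|_{\mathcal{U}^p_\rho}=\mu^p_\rho(f,[a,b])^{1/p}$. A function $f:[a,b]\to X$ is $\rho$-SKH integrable if there is a function $F:[a,b]\to X$ such that for every $\varepsilon>0$ there is a gauge $\delta$ on $[a,b]$ such that $(D)\sum\rho\big(F(v)-F(u)-f(t)(v-u)\big)<\varepsilon$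 for every $\delta$-fine tagged partition $D$ of $[a,b]$. A real function $g:[a,b]\to\mathbb{R}$ is Kurzweil--Henstock integrable if there is $z\in\mathbb{R}$ such that for every $\varepsilon>0$ there is a gauge $\delta$ with $|(D)\sum g(t)(v-u)-z|<\varepsilon$ for every $\delta$-fine tagged partition $D$ of $[a,b]$. $L^p_\rho([a,b];X)$ is the set of all $f:[a,b]\to X$ such that $f$ is $\rho$-SKH integrable and $t\mapsto\rho(f(t))^p$ is Kurzweil--Henstock integrable on $[a,b]$. *)

(* Defs.v *)
From HB Require Import structures.
From mathcomp Require Import all_boot all_order all_algebra.
From mathcomp Require Import all_classical all_reals all_analysis.

Set Implicit Arguments.
Unset Strict Implicit.
Unset Printing Implicit Defensive.

Import Order.TTheory GRing.Theory Num.Theory.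

Local Open Scope classical_set_scope.
Local Open Scope ring_scope.

Section SemiNorm.
Context {R : realType} {X : lmodType R}.
Implicit Type rho : X -> R.

Record seminorm rho : Prop := Seminorm {
  seminormD : forall u v : X, rho (u + v) <= rho u + rho v ;
  seminormZ : forall (c : R) (u : X), rho (c *: u) = `|c| * rho u }.

Definition sn_cauchy rho (u : nat -> X) : Prop :=
  forall e : R, 0 < e -> exists N : nat, forall m n : nat,
    (N <= m)%N -> (N <= n)%N -> rho (u m - u n) < e.

Definition sn_converges_to rho (u : nat -> X) (l : X) : Prop :=
  forall e : R, 0 < e -> exists N : nat, forall n : nat,
    (N <= n)%N -> rho (u n - l) < e.

Definition sequentially_complete rho : Prop :=
  forall u : nat -> X, sn_cauchy rho u ->
    exists l : X, sn_converges_to rho u l.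

End SemiNorm.

(* Functions on [a, b] are functions on the subtype [seg a b]. *)
Definition seg {R : realType} (a b : R) : Type := {x : R | x \in `[a, b]}.

Section TaggedPartitions.
Context {R : realType} {a b : R}.

Definition is_gauge (delta : seg a b -> R) : Prop := forall t, 0 < delta t.

(* ((u, v), t) stands for the tagged interval ([u, v], t). *)
Definition tagged_interval : Type := (seg a b * seg a b * seg a b)%type.

Definition ti_lo (J : tagged_interval) : seg a b := J.1.1.
Definition ti_hi (J : tagged_interval) : seg a b := J.1.2.
Definition ti_tag (J : tagged_interval) : seg a b := J.2.
Definition ti_len (J : tagged_interval) : R := val (ti_hi J) - val (ti_lo J).

(* [pairwise] compares the members at two different positions, so a repeated
   interval counts as overlapping. *)
Record tagged_partition (D : seq tagged_interval) : Prop := TaggedPartition {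
  tp_nondegenerate : forall J, J \in D -> val (ti_lo J) < val (ti_hi J) ;
  tp_tag : forall J, J \in D ->
    val (ti_tag J) \in `[val (ti_lo J), val (ti_hi J)] ;
  tp_nonoverlapping : pairwise
    (fun J K => (val (ti_hi J) <= val (ti_lo K)) ||
                (val (ti_hi K) <= val (ti_lo J))) D ;
  tp_cover :
    \big[setU/set0]_(J <- D) `[val (ti_lo J), val (ti_hi J)]%classic
    = `[a, b]%classic }.

Definition fine_partition (delta : seg a b -> R) (D : seq tagged_interval) :
    Prop :=
  tagged_partition D /\
  forall J, J \in D ->
    `[val (ti_lo J), val (ti_hi J)]%classic `<=`
    `]val (ti_tag J) - delta (ti_tag J),
      val (ti_tag J) + delta (ti_tag J)[%classic.

Definition KH_integrable (g : seg a b -> R) : Prop :=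
  exists z : R, forall e : R, 0 < e ->
    exists2 delta, is_gauge delta & forall D, fine_partition delta D ->
      `| \sum_(J <- D) g (ti_tag J) * ti_len J - z | < e.

End TaggedPartitions.

Section FunctionSpaces.
Context {R : realType} {X : lmodType R}.
Variables (rho : X -> R) (a b : R).

Definition SKH_integrable (f : seg a b -> X) : Prop :=
  exists F : seg a b -> X, forall e : R, 0 < e ->
    exists2 delta, is_gauge delta & forall D, fine_partition delta D ->
      \sum_(J <- D)
        rho (F (ti_hi J) - F (ti_lo J) - ti_len J *: f (ti_tag J)) < e.

Variable p : R.

Definition mu_rho (f : seg a b -> X) : \bar R :=
  ereal_inf [set
    ereal_sup [set (\sum_(J <- D) rho (f (ti_tag J)) `^ p * ti_len J)%:E
              | D in fine_partition delta]
  | delta in is_gauge].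

Definition U_norm (f : seg a b -> X) : \bar R := (mu_rho f `^ p^-1)%E.

Definition U_rho : set (seg a b -> X) := [set f | (mu_rho f < +oo)%E].

Definition L_rho : set (seg a b -> X) :=
  [set f | SKH_integrable f /\ KH_integrable (fun t => rho (f t) `^ p)].

Definition U_space : Type := set_type U_rho.

HB.instance Definition _ := Choice.copy U_space (set_type U_rho).

Definition U_open : set_system U_space := [set A | forall f : U_space, A f ->
  exists2 r : R, 0 < r &
    forall g : U_space, (U_norm (val g - val f)%R < r%:E)%E -> A g].

Lemma U_openT : U_open setT.
Proof. by move=> f _; exists 1. Qed.

Lemma U_openI : setI_closed U_open.
Proof.
move=> A B oA oB f [/oA[r r0 Ar] /oB[s s0 Bs]].
exists (Num.min r s); first by rewrite lt_min r0.
move=> g gf; split; [apply: Ar|apply: Bs]; apply: (lt_le_trans gf);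
  by rewrite lee_fin ge_min lexx ?orbT.
Qed.

Lemma U_open_bigU (I : Type) (A : I -> set U_space) :
  (forall i, U_open (A i)) -> U_open (\bigcup_i A i).
Proof.
move=> oA f [i _ /oA[r r0 Ar]]; exists r => // g /Ar Ag.
by exists i.
Qed.

HB.instance Definition _ :=
  isOpenTopological.Build U_space U_openT U_openI U_open_bigU.

End FunctionSpaces.

Arguments U_rho {R X} rho a b p.
Arguments L_rho {R X} rho a b p.

(* Main.v *)
Require Import Defs.
From mathcomp Require Import all_boot all_order all_algebra.
From mathcomp Require Import all_classical all_reals all_analysis.
From mathcomp Require Import measurable_realfun lra.

(** A real function on [a, b] is compared with the Lebesgue integral of Borel
    majorants and minorants: covering its level sets by open sets gives a gauge
    whose Riemann sums are at most (nearly) the integral of a majorant, and the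
    same estimate applied to [c - g] bounds them from below.

    [L_rho] is then the closure of the Borel simple functions for the upper
    Kurzweil-Henstock [p]-integral, and closures of subspaces are closed
    subspaces. A limit of simple functions is SKH integrable because the
    primitives of the simple functions are Cauchy. Conversely let [f] be SKH
    integrable with primitive [F]. A Vitali argument, carried out inside the
    bisection tree of [a, b] where maximal disjoint intervals are found for
    free, shows that the difference quotients of [F] on the bisection intervals
    (which are step functions) converge to [f] almost everywhere; truncating
    them and using dominated convergence gives the approximation. *)

Set Implicit Arguments.
Unset Strict Implicit.
Unset Printing Implicit Defensive.

Import Order.TTheory GRing.Theory Num.Theory.
Import numFieldNormedType.Exports.
Local Open Scope classical_set_scope.
Local Open Scope ring_scope.

(** * Upper sums and their Lebesgue majorants *)

Section UpperSums.
Context {R : realType} {a b : R}.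
Implicit Types (g h : seg a b -> R) (D : seq (@tagged_interval R a b)).
Local Notation mu := (@lebesgue_measure R).

(** [X] carries no measurable structure and need not be separable, so no vector-valued function is
    ever integrated: a simple function is a list of pairs, and Lebesgue integrals are taken only of
    real functions such as [rho (simple_fun s x)]. For the same reason nothing is known beforehand
    about the measurability of [rho (f t)], and the definition of [L_rho] shows neither linearity
    nor closedness: integrability of the p-th power of [rho (f t)] does not pass to sums by itself.
    Measurability comes from SKH integrability, through the step functions that converge almost
    everywhere. Approximation in p-mean merges both conditions into one estimate on upper sums, and
    the triangle inequality carries that estimate over to linear combinations and limits. No
    dominating function for the difference quotients is at hand, hence the truncation, at a level
    where the tail of [f] is already small. *)

Definition riemann_sum g D : R := \sum_(J <- D) g (ti_tag J) * ti_len J.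

(** One gauge achieves the bound [e] itself, which avoids extended reals: [mu_rho < e] implies this
    property for the p-th power of [rho (f t)], and the property implies [mu_rho <= e]. *)
Definition upper_sums_le g (e : R) : Prop :=
  exists2 delta, is_gauge delta &
    forall D, fine_partition delta D -> riemann_sum g D <= e.

(** Half-open, so that non-overlapping intervals become disjoint and integrals over them add up. *)
Definition co_itv (J : @tagged_interval R a b) : set R :=
  `[val (ti_lo J), val (ti_hi J)[%classic.

Lemma seg_itv (t : seg a b) : a <= val t <= b.
Proof. by have := valP t; rewrite in_itv. Qed.

Lemma ti_len_gt0 D J : tagged_partition D -> J \in D -> 0 < ti_len J.
Proof. by move=> tD JD; rewrite subr_gt0; exact: (tp_nondegenerate tD). Qed.

Lemma fine_partitionS (d1 d2 : seg a b -> R) D : (forall t, d1 t <= d2 t) ->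
  fine_partition d1 D -> fine_partition d2 D.
Proof.
move=> d12 [tD fD]; split=> // J /fD JD x /JD /=.
rewrite !in_itv /= => /andP[x1 x2]; have d := d12 (ti_tag J).
by rewrite (le_lt_trans _ x1) ?(lt_le_trans x2) ?lerD2l ?lerN2.
Qed.

Lemma fine_partition_min (d1 d2 : seg a b -> R) D :
  fine_partition (fun t => Num.min (d1 t) (d2 t)) D ->
  fine_partition d1 D /\ fine_partition d2 D.
Proof.
by move=> fD; split; apply: fine_partitionS fD => t; rewrite ge_min lexx ?orbT.
Qed.

Lemma is_gauge_min (d1 d2 : seg a b -> R) : is_gauge d1 -> is_gauge d2 ->
  is_gauge (fun t => Num.min (d1 t) (d2 t)).
Proof. by move=> g1 g2 t; rewrite lt_min g1 g2. Qed.

Lemma riemann_sum_le g h D : tagged_partition D -> (forall t, g t <= h t) ->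
  riemann_sum g D <= riemann_sum h D.
Proof.
move=> tD gh; rewrite /riemann_sum big_seq [leRHS]big_seq.
by apply: ler_sum => J JD; rewrite ler_wpM2r// ltW// (ti_len_gt0 tD).
Qed.

Lemma riemann_sum_ge0 g D : tagged_partition D -> (forall t, 0 <= g t) ->
  0 <= riemann_sum g D.
Proof.
move=> tD g0; rewrite /riemann_sum big_seq.
by apply: sumr_ge0 => J JD; rewrite mulr_ge0// ltW// (ti_len_gt0 tD).
Qed.

Lemma riemann_sumD g h D :
  riemann_sum (fun t => g t + h t) D = riemann_sum g D + riemann_sum h D.
Proof. by rewrite -big_split; apply: eq_bigr => J _; rewrite mulrDl. Qed.

Lemma riemann_sumZ c g D :
  riemann_sum (fun t => c * g t) D = c * riemann_sum g D.
Proof. by rewrite mulr_sumr; apply: eq_bigr => J _; rewrite mulrA. Qed.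

Lemma upper_sums_leD g h e e' : upper_sums_le g e -> upper_sums_le h e' ->
  upper_sums_le (fun t => g t + h t) (e + e').
Proof.
move=> [d1 d1g D1] [d2 d2g D2].
exists (fun t => Num.min (d1 t) (d2 t)); first exact: is_gauge_min.
by move=> D /fine_partition_min[/D1 ? /D2 ?]; rewrite riemann_sumD lerD.
Qed.

Lemma upper_sums_leZ c g e : 0 <= c -> upper_sums_le g e ->
  upper_sums_le (fun t => c * g t) (c * e).
Proof.
by move=> c0 [d dg De]; exists d => // D /De ?; rewrite riemann_sumZ ler_wpM2l.
Qed.

Lemma upper_sums_leW g h e e' : (forall t, g t <= h t) -> e <= e' ->
  upper_sums_le h e -> upper_sums_le g e'.
Proof.
move=> gh ee' [d dg De]; exists d => // D fD.
by rewrite (le_trans _ ee')// (le_trans _ (De _ fD))// riemann_sum_le//; case: fD.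
Qed.

Lemma sub_partition D J : tagged_partition D -> J \in D ->
  `[val (ti_lo J), val (ti_hi J)]%classic `<=` `[a, b]%classic.
Proof.
move=> tD JD; rewrite -(tp_cover tD) -bigcup_seq.
by move=> x Jx; exists J.
Qed.

Lemma co_itv_sub D J : tagged_partition D -> J \in D ->
  co_itv J `<=` `[a, b]%classic.
Proof.
move=> tD JD; apply: subset_trans (sub_partition tD JD) => x.
by rewrite /co_itv /= !in_itv /= => /andP[-> /ltW].
Qed.

Lemma trivIset_co_itv D : tagged_partition D ->
  uniq D /\ trivIset [set` D] co_itv.
Proof.
move=> tD.
(* A non-degenerate interval overlaps itself, so distinctness can be added to the relation; it
   yields [uniq]. *)
have nonov : pairwise (fun J K : @tagged_interval R a b =>
    (J != K) && ((val (ti_hi J) <= val (ti_lo K)) ||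
                (val (ti_hi K) <= val (ti_lo J)))) D.
  have : all [pred J : @tagged_interval R a b | val (ti_lo J) < val (ti_hi J)] D.
    by apply/allP => J /(tp_nondegenerate tD).
  move: (tp_nonoverlapping tD); elim: D {tD} => //= J D IH /andP[JD /IH{}IH] /andP[lJ].
  move=> aD; rewrite IH// andbT; apply/allP => K KD.
  have JK := allP JD _ KD; rewrite JK andbT.
  by apply: contraTneq JK => <-; rewrite orbb -ltNge.
split.
  by rewrite uniq_pairwise; apply: sub_pairwise nonov => J K /andP[].
have nonovJ J K x : co_itv J x -> co_itv K x ->
    ~ (val (ti_hi J) <= val (ti_lo K)).
  rewrite /co_itv /= !in_itv /= => /andP[_ xJ] /andP[xK _] JK.
  by have := lt_le_trans xJ (le_trans JK xK); rewrite ltxx.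
apply/trivIsetP => J K JD KD JK; apply/eqP; apply/negPn/negP => /set0P[x [Jx Kx]].
suff : (val (ti_hi J) <= val (ti_lo K)) || (val (ti_hi K) <= val (ti_lo J)).
  by move=> /orP[]; [exact: nonovJ Jx Kx|exact: nonovJ Kx Jx].
move: nonov JD KD JK => {nonovJ}; elim: D {tD} => //= L D IH /andP[LD nD].
rewrite !inE => /predU1P[->|JD] /predU1P[->|KD] JK.
- by rewrite eqxx in JK.
- by have /andP[] := allP LD _ KD.
- by have /andP[_] := allP LD _ JD; rewrite orbC.
- exact: IH.
Qed.

Lemma measurable_segment : measurable (`[a, b]%classic : set R).
Proof. exact: measurable_itv. Qed.

Lemma measurable_co_itv J : measurable (co_itv J).
Proof. exact: measurable_itv. Qed.

#[local] Hint Resolve measurable_segment measurable_co_itv : core.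

Lemma co_itv_measure D J : tagged_partition D -> J \in D ->
  mu (co_itv J) = (ti_len J)%:E.
Proof.
move=> tD JD; rewrite /co_itv lebesgue_measure_itv/= lte_fin.
by rewrite (tp_nondegenerate tD JD) EFinB.
Qed.

Lemma sum_integral_co_itv_le D (w : R -> \bar R) : tagged_partition D ->
  measurable_fun `[a, b] w -> (forall x, `[a, b]%classic x -> (0 <= w x)%E) ->
  (\sum_(J <- D) \int[mu]_(x in co_itv J) w x <=
   \int[mu]_(x in `[a, b]) w x)%E.
Proof.
move=> tD mw w0; have [uD triv] := trivIset_co_itv tD.
have sub : \big[setU/set0]_(J <- D) co_itv J `<=` `[a, b]%classic.
  by rewrite -bigcup_seq => x [J /= JD]; exact: (co_itv_sub tD JD).
have mbig : measurable (\big[setU/set0]_(J <- D) co_itv J : set R).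
  exact: bigsetU_measurable.
rewrite -ge0_integral_bigsetU//.
- exact: ge0_subset_integral.
- exact: measurable_co_itv.
- exact: (measurable_funS measurable_segment sub mw).
- by move=> x /sub; exact: w0.
Qed.

Lemma sum_ti_len_ge D : a < b -> tagged_partition D -> b - a <= \sum_(J <- D) ti_len J.
Proof.
move=> ab tD; rewrite -lee_fin -sumEFin.
have <- : mu `[a, b]%classic = (b - a)%:E.
  by rewrite lebesgue_measure_itv/= lte_fin ab EFinB.
rewrite -(tp_cover tD).
have len J : J \in D ->
    mu `[val (ti_lo J), val (ti_hi J)]%classic = (ti_len J)%:E.
  by move=> /(tp_nondegenerate tD) J0; rewrite lebesgue_measure_itv/= lte_fin J0 EFinB.
rewrite [leRHS]big_seq -(eq_bigr _ len) -big_seq.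
elim: D {tD len} => [|J D IH]; first by rewrite !big_nil measure0.
rewrite !big_cons (le_trans (measureU2 _ _ _)) ?leeD2l//.
exact: bigsetU_measurable.
Qed.

(** The radius on which [w] stays above [g t] serves as gauge: on a fine interval [w] dominates the
    value at the tag, so each Riemann term is at most the integral of [w] over that interval. *)
Lemma upper_sums_le_lsc g (w : R -> \bar R) e :
  (forall t, 0 <= g t) ->
  measurable_fun `[a, b] w -> (forall x, `[a, b]%classic x -> (0 <= w x)%E) ->
  (forall t : seg a b, exists2 d : R, 0 < d &
    forall s, `|s - val t| < d -> ((g t)%:E <= w s)%E) ->
  (\int[mu]_(x in `[a, b]) w x <= e%:E)%E -> upper_sums_le g e.
Proof.
move=> g0 mw w0 lsc we.
have /choice[d dP] : forall t : seg a b, exists d : R, 0 < d /\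
    forall s, `|s - val t| < d -> ((g t)%:E <= w s)%E.
  by move=> t; have [d ? ?] := lsc t; exists d.
exists d => [t|D [tD fD]]; first by case: (dP t).
rewrite -lee_fin (le_trans _ we)//.
apply: le_trans (sum_integral_co_itv_le tD mw w0).
rewrite /riemann_sum -sumEFin big_seq [leRHS]big_seq; apply: lee_sum => J JD.
have -> : (g (ti_tag J) * ti_len J)%:E = (\int[mu]_(x in co_itv J) (g (ti_tag J))%:E)%E.
  rewrite EFinM -(co_itv_measure tD JD); apply/esym.
  exact: (integral_cst mu (measurable_co_itv J) (g (ti_tag J))%:E).
apply: ge0_le_integral => //=.
- exact: measurable_co_itv.
- by move=> x _; rewrite lee_fin.
- exact: (measurable_funS measurable_segment (co_itv_sub tD JD) mw).
- move=> s Js; have [_] := dP (ti_tag J); apply.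
  have /(fD J JD) : `[val (ti_lo J), val (ti_hi J)]%classic s.
    by move: Js; rewrite /co_itv /= !in_itv /= => /andP[-> /ltW->].
  by rewrite /= in_itv /= -ltr_distlC distrC.
Qed.

End UpperSums.

(** * Open covers of level sets *)

Section UpperSumsIntegral.
Context {R : realType} {a b : R}.
Implicit Types (g h : seg a b -> R) (D : seq (@tagged_interval R a b)).
Local Notation mu := (@lebesgue_measure R).

(** Enlarging each [E k] slightly to an open [U k] makes the sum [w] of the [c k] times the
    indicators of [U k] a majorant of the kind needed above: near a point of [E k] it stays at least
    [c k]. *)
Lemma upper_sums_le_cover g (E : nat -> set R) (c : nat -> R) e :
  (forall t, 0 <= g t) -> (forall k, measurable (E k)) ->
  (forall k, E k `<=` `[a, b]%classic) -> (forall k, 0 <= c k) ->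
  (forall t : seg a b, exists k, E k (val t) /\ g t <= c k) ->
  (\sum_(k <oo) (c k)%:E * mu (E k) < e%:E)%E -> upper_sums_le g e.
Proof.
move=> g0 mE Eab c0 Eg; set S := (\sum_(k <oo) _)%E => Se.
have cE0 k : (0 <= (c k)%:E * mu (E k))%E by rewrite mule_ge0 ?lee_fin.
have S0 : (0 <= S)%E by apply: nneseries_ge0 => k _ _.
have Sfin : S \is a fin_num.
  by rewrite ge0_fin_numE// (lt_trans Se)// ltry.
pose eta := e - fine S.
have eta0 : 0 < eta by rewrite subr_gt0 -lte_fin fineK.
(* The slack [eta] is shared out geometrically. Dividing by [c k + 1] keeps [c k] times the excess
   measure below the k-th share and allows [c k = 0]. *)
have /choice[U UP] : forall k, exists U : set R, [/\ open U, E k `<=` U &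
    (mu (U `\` E k) < (eta / (2 ^ k.+1)%:R / (c k + 1))%:E)%E].
  move=> k; apply: lebesgue_regularity_outer => //.
  - apply: (@le_lt_trans _ _ (mu `[a, b]%classic)).
      by apply: le_measure; rewrite ?inE; [exact: mE|exact: measurable_segment|exact: Eab].
    by rewrite lebesgue_measure_itv/=; case: ifP => _; rewrite -?EFinB ltry.
  - by rewrite divr_gt0 ?ltr_wpDl// divr_gt0// ltr0n expn_gt0.
have mU k : measurable (U k) by have [oU _ _] := UP k; exact: open_measurable.
pose w (x : R) : \bar R := (\sum_(k <oo) (c k)%:E * (\1_(U k) x)%:E)%E.
have cU0 k x : (0 <= (c k)%:E * (\1_(U k) x)%:E)%E.
  by rewrite mule_ge0 ?lee_fin.
have mcU k : measurable_fun `[a, b]%classic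
    (fun x : R => (c k)%:E * (\1_(U k) x)%:E)%E.
  apply: emeasurable_funM => //; apply/measurable_EFinP.
  exact: measurable_indic.
apply: (@upper_sums_le_lsc _ _ _ _ w) => //.
- exact: ge0_emeasurable_sum.
- by move=> x _; exact: nneseries_ge0.
- move=> t; have [k [Ekt gc]] := Eg t; have [oU EU _] := UP k.
  have /nbhs_ballP[d /= d0 dU] := open_nbhs_nbhs (conj oU (EU _ Ekt)).
  exists d => // s sd; have Us : U k s by apply: dU; rewrite /ball/= distrC.
  apply: (@le_trans _ _ (c k)%:E); first by rewrite lee_fin.
  rewrite /w (@nneseriesD1 _ _ k)// indicE mem_set// mule1 leeDl//.
  by apply: nneseries_ge0 => n _ _; exact: cU0.
rewrite /w integral_nneseries//.
have -> : e%:E = (S + eta%:E)%E by rewrite /eta EFinB fineK// addeCA subee// adde0.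
apply: le_trans (epsilon_trick xpredT cE0 (ltW eta0)).
apply: lee_nneseries => [k _ _|k _].
  by apply: integral_ge0 => x _; exact: cU0.
have [oU EU Uk] := UP k.
rewrite ge0_integralZl ?lee_fin//; last first.
  by apply/measurable_EFinP; apply: measurable_indic; exact: mU.
rewrite integral_indic; [|by []|exact: mU].
apply: (@le_trans _ _ ((c k)%:E * (mu (E k) + (eta / (2 ^ k.+1)%:R / (c k + 1))%:E))%E).
  rewrite lee_wpmul2l ?lee_fin//.
  have mUE : measurable (U k `\` E k) by apply: measurableD; [exact: mU|exact: mE].
  apply: (@le_trans _ _ (mu (E k `|` (U k `\` E k)))).
    apply: le_measure; rewrite ?inE.
    - by apply: measurableI; [exact: mU|exact: measurable_segment].
    - by apply: measurableU; [exact: mE|].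
    - by rewrite setDUK// => x [].
  apply: (le_trans (measureU2 mu (mE k) mUE)).
  by rewrite leeD2l// ltW.
have q0 : 0 <= eta / (2 ^ k.+1)%:R by rewrite divr_ge0// ltW.
have ck : 0 < c k + 1 by rewrite ltr_wpDl.
rewrite ge0_muleDr ?lee_fin ?(divr_ge0 q0) ?(ltW ck)//.
rewrite leeD2l// -EFinM lee_fin mulrCA ler_piMr//.
by rewrite ler_pdivrMr ?mul1r ?lerDl// ltr_wpDl.
Qed.

(* [g] may be unbounded on [N]: each of its level sets gets its own small open cover. *)
Lemma upper_sums_le_null g (N : set R) e :
  (forall t, 0 <= g t) -> measurable N -> N `<=` `[a, b]%classic -> mu N = 0%E ->
  (forall t, ~ N (val t) -> g t = 0) -> 0 < e -> upper_sums_le g e.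
Proof.
move=> g0 mN Nab N0 gN e0.
(* Height 0 on the whole segment serves the points off [N]; height [k] on [N], for every positive
   [k], serves the points of [N] however large [g] is there. *)
apply: (@upper_sums_le_cover g (fun k => if k is 0%N then `[a, b]%classic else N)
  (fun k => k%:R)) => //.
- by case.
- by case=> //=; exact: subset_refl.
- move=> t; have [Nt|Nt] := pselect (N (val t)).
    exists (Num.truncn (g t)).+1; split=> //.
    by rewrite ltW// truncnS_gt.
  by exists 0%N; rewrite gN//; split => //=; have := valP t.
- rewrite eseries0// => -[|k] _ _; first by rewrite mul0e.
  by rewrite N0 mule0.
Qed.

Definition conull (D : set R) := [/\ measurable D, D `<=` `[a, b]%classic &
  mu (`[a, b]%classic `\` D) = 0%E].

(** [D] is sliced into the sets where [h] lies between consecutive multiples of [r]. Covering each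
    slice at its upper height overestimates the integral by at most [r] times the measure of [D]. *)
Lemma upper_sums_le_integral g (D : set R) (h : R -> R) e : conull D ->
  (forall t, 0 <= g t) -> measurable_fun D h -> (forall x, D x -> 0 <= h x) ->
  (forall t, D (val t) -> g t <= h (val t)) ->
  (\int[mu]_(x in D) (h x)%:E < e%:E)%E -> upper_sums_le g e.
Proof.
move=> [mD Dab D0] g0 mh h0 gh he.
have I0 : (0 <= \int[mu]_(x in D) (h x)%:E)%E.
  by apply: integral_ge0 => x Dx; rewrite lee_fin h0.
have Ifin : (\int[mu]_(x in D) (h x)%:E)%E \is a fin_num.
  by rewrite ge0_fin_numE// (lt_trans he)// ltry.
pose I := fine (\int[mu]_(x in D) (h x)%:E)%E.
have Ie : I < e by rewrite -lte_fin fineK.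
(* Half of the gap between the integral and [e] pays for rounding [h] up to a multiple of [r], the
   other half for the null complement of [D]. *)
pose r := (e - I) / 2 / (`|b - a| + 1).
have r0 : 0 < r by rewrite !divr_gt0 ?subr_gt0// ltr_wpDl.
have rab : r * `|b - a| < (e - I) / 2.
  rewrite /r -mulrA gtr_pMr ?divr_gt0 ?subr_gt0//.
  by rewrite -ltr_pdivlMl ?invr_gt0 ?ltr_wpDl// invrK mulr1 ltrDl.
clearbody r; pose E k := D `&` [set x | k%:R * r <= h x < k.+1%:R * r].
have mE k : measurable (E k).
  rewrite /E (_ : [set x | _] = h @^-1` `[k%:R * r, k.+1%:R * r[%classic).
    by apply: mh => //; exact: measurable_itv.
  by apply/seteqP; split => x /=; rewrite in_itv.
have Eh x : D x -> exists k, E k x.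
  move=> Dx; exists (Num.truncn (h x / r)); split => //=.
  rewrite -ler_pdivlMr// -ltr_pdivrMr// truncn_le ?truncnS_gt//.
  by rewrite divr_ge0 ?h0 ?ltW.
have <- : (e - (e - I) / 2) + (e - I) / 2 = e by lra.
pose gD (t : seg a b) := if val t \in D then g t else 0.
pose gN (t : seg a b) := if val t \in D then 0 else g t.
apply: (@upper_sums_leW _ _ _ _ (fun t => gD t + gN t) _ _ _ (lexx _)).
  by move=> t; rewrite /gD /gN; case: ifP => _; rewrite ?addr0 ?add0r.
apply: upper_sums_leD; last first.
  apply: (@upper_sums_le_null _ (`[a, b]%classic `\` D)) => //.
  - by move=> t; rewrite /gN; case: ifP.
  - exact: measurableD.
  - by move=> t /= Dt; rewrite /gN; case: ifPn => // /negP tD; case: Dt;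
      split; [exact: valP|move=> Dt; apply: tD; rewrite inE].
  - by rewrite divr_gt0 ?subr_gt0.
(* The shift of index gives the slice [E k] its upper height [k.+1 * r]; index 0, of height 0, takes
   the points off [D], where [gD] vanishes. *)
apply: (@upper_sums_le_cover _ (fun k => if k is k.+1 then E k else `[a, b]%classic)
  (fun k => k%:R * r)).
- by move=> t; rewrite /gD; case: ifP.
- by case.
- by case=> [|k]; [exact: subset_refl|move=> x [Dx _]; exact: Dab].
- by move=> k; rewrite mulr_ge0// ltW.
- move=> t; rewrite /gD; case: ifPn => [|_].
    rewrite inE => Dt; have [k Ek] := Eh _ Dt; exists k.+1; split=> //.
    by rewrite (le_trans (gh _ Dt))//; case: Ek => _ /andP[_ /ltW].
  by exists 0%N; rewrite mul0r; split=> //=; have := valP t.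
have triv : trivIset setT E.
  apply: ltn_trivIset => n m mn; apply/eqP/negPn/negP.
  move=> /set0P[x [[_ /andP[_ xm]] [_ /andP[nx _]]]].
  have := le_lt_trans nx xm; rewrite ltr_pM2r// ltr_nat ltnS.
  by rewrite leqNgt mn.
have DE : D = \bigcup_k E k.
  by apply/seteqP; split => [x /Eh[k Ek]|x [k _ []//]]; exists k.
apply: (@le_lt_trans _ _ (\int[mu]_(x in D) ((h x)%:E + r%:E))%E).
  rewrite [in leRHS]DE ge0_integral_bigcup//; last 2 first.
  - rewrite -DE; apply: emeasurable_funD => //; exact/measurable_EFinP.
  - by rewrite -DE => x Dx; rewrite adde_ge0 ?lee_fin ?h0 ?ltW.
  have F0 k : (0 <= (k%:R * r)%:E * mu (if k is k.+1 then E k else `[a, b]%classic))%E.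
    by apply: mule_ge0; rewrite ?lee_fin ?mulr_ge0 ?(ltW r0).
  rewrite (@nneseries_recl _ xpredT)// mul0r mul0e add0e -nneseries_addn//.
  apply: lee_nneseries => [k _ _|k _]; first by rewrite addn1; exact: (F0 k.+1).
  rewrite addn1 -integral_cst; last exact: mE.
  have EkD : E k `<=` D by move=> x [].
  apply: ge0_le_integral => //=.
  - exact: mE.
  - by move=> x _; rewrite lee_fin mulr_ge0// ltW.
  - apply: emeasurable_funD => //; apply/measurable_EFinP.
    exact: measurable_funS EkD mh.
  - move=> x [_ /andP[kx _]]; rewrite -EFinD lee_fin.
    by rewrite -natr1 mulrDl mul1r lerD2r.
rewrite ge0_integralD//; last 2 first.
- exact/measurable_EFinP.
- by move=> x _; rewrite lee_fin ltW.
rewrite integral_cst; last exact: mD.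
have -> : (e - (e - I) / 2)%:E = (I%:E + ((e - I) / 2)%:E)%E.
  by rewrite -EFinD; congr EFin; lra.
rewrite /I fineK// lteD2lE//.
have Dle : (mu D <= `|b - a|%:E)%E.
  apply: (@le_trans _ _ (mu `[a, b]%classic)).
    by apply: le_measure; rewrite ?inE; [exact: mD|exact: measurable_segment|exact: Dab].
  rewrite lebesgue_measure_itv/=; case: ifP => _; last by rewrite lee_fin.
  by rewrite -EFinB lee_fin ler_norm.
apply: (@le_lt_trans _ _ (r%:E * `|b - a|%:E)%E).
  by rewrite lee_wpmul2l// lee_fin ltW.
by rewrite -EFinM lte_fin.
Qed.

End UpperSumsIntegral.

(** * Fine partitions and Lebesgue minorants *)

Section Cousin.
Context {R : realType} {a b : R}.
Implicit Types (D : seq (@tagged_interval R a b)) (delta : seg a b -> R).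

Definition nonoverlapping (J K : @tagged_interval R a b) : bool :=
  (val (ti_hi J) <= val (ti_lo K)) || (val (ti_hi K) <= val (ti_lo J)).

(** The subinterval version of [fine_partition]: concatenation and bisection need partitions of
    [[u, v]], while the gauge stays defined on the whole segment. *)
Record fine_partition_of delta (u v : R) D : Prop := FinePartitionOf {
  fpo_nondegenerate : forall J, J \in D -> val (ti_lo J) < val (ti_hi J) ;
  fpo_tag : forall J, J \in D ->
    val (ti_tag J) \in `[val (ti_lo J), val (ti_hi J)] ;
  fpo_nonoverlapping : pairwise nonoverlapping D ;
  fpo_cover : \big[setU/set0]_(J <- D)
    `[val (ti_lo J), val (ti_hi J)]%classic = `[u, v]%classic ;
  fpo_fine : forall J, J \in D ->
    `[val (ti_lo J), val (ti_hi J)]%classic `<=`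
    `]val (ti_tag J) - delta (ti_tag J), val (ti_tag J) + delta (ti_tag J)[%classic }.

Lemma fine_partition_of_total delta D :
  fine_partition_of delta a b D -> fine_partition delta D.
Proof. by case=> nd tg no co fi; split. Qed.

Lemma fine_partition_of_sub delta u v D J : fine_partition_of delta u v D ->
  J \in D -> u <= val (ti_lo J) /\ val (ti_hi J) <= v.
Proof.
move=> P JD; have lohi := fpo_nondegenerate P JD.
have sub : `[val (ti_lo J), val (ti_hi J)]%classic `<=` `[u, v]%classic.
  by rewrite -(fpo_cover P) -bigcup_seq => x Jx; exists J.
have /sub : `[val (ti_lo J), val (ti_hi J)]%classic (val (ti_lo J)).
  by rewrite /= in_itv /= lexx ltW.
have /sub : `[val (ti_lo J), val (ti_hi J)]%classic (val (ti_hi J)).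
  by rewrite /= in_itv /= lexx ltW.
by rewrite /= !in_itv /= => /andP[_ ->] /andP[-> _].
Qed.

Lemma fine_partition_of_cat delta u m v D1 D2 : u <= m -> m <= v ->
  fine_partition_of delta u m D1 -> fine_partition_of delta m v D2 ->
  fine_partition_of delta u v (D1 ++ D2).
Proof.
move=> um mv P1 P2; split.
- by move=> J; rewrite mem_cat => /orP[/(fpo_nondegenerate P1)|/(fpo_nondegenerate P2)].
- by move=> J; rewrite mem_cat => /orP[/(fpo_tag P1)|/(fpo_tag P2)].
- rewrite pairwise_cat (fpo_nonoverlapping P1) (fpo_nonoverlapping P2) !andbT.
  apply/allrelP => J K JD KD; apply/orP; left.
  have [_ Jm] := fine_partition_of_sub P1 JD.
  by have [mK _] := fine_partition_of_sub P2 KD; exact: le_trans mK.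
- rewrite big_cat/= (fpo_cover P1) (fpo_cover P2); apply/seteqP; split => x /=.
    by rewrite !in_itv /= => -[/andP[-> xm]|/andP[mx ->]];
      rewrite ?(le_trans xm)// (le_trans um).
  rewrite !in_itv /= => /andP[ux xv].
  by have [xm|/ltW mx] := leP x m; [left|right]; rewrite ?ux ?xm ?mx ?xv.
- by move=> J; rewrite mem_cat => /orP[/(fpo_fine P1)|/(fpo_fine P2)].
Qed.

Lemma fine_partition_of1 delta (u v t : seg a b) : val u < val v ->
  val u <= val t -> val t <= val v ->
  val t - delta t < val u -> val v < val t + delta t ->
  fine_partition_of delta (val u) (val v) [:: (u, v, t)].
Proof.
move=> uv ut tv tu vt; split => [J|J||| J].
- by rewrite inE => /eqP->.
- by rewrite inE => /eqP->; rewrite in_itv /= ut tv.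
- by [].
- by rewrite big_seq1.
- rewrite inE => /eqP-> x /=; rewrite !in_itv /= => /andP[ux xv].
  by rewrite (lt_le_trans tu)// (le_lt_trans xv).
Qed.

Lemma mem_seg (x : R) (u v : seg a b) : val u <= x -> x <= val v -> x \in `[a, b].
Proof.
move=> ux xv; have /andP[au _] := seg_itv u; have /andP[_ vb] := seg_itv v.
by rewrite in_itv /= (le_trans au)// (le_trans xv).
Qed.

(** Let [s] be the supremum of the points reachable from [u]. The radius of the gauge at [s] reaches
    back to a reachable point and forward to some [y], so one more interval tagged at [s] makes [y]
    reachable; hence [y] is [v], or [s] would be exceeded. *)
Lemma cousin delta (u v : seg a b) : is_gauge delta -> val u < val v ->
  exists D, fine_partition_of delta (val u) (val v) D.
Proof.
move=> d0 uv.
(* The alternative [x = val u] starts the argument: a degenerate interval has no partition into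
   non-degenerate ones. *)
pose S := [set x : R | val u <= x <= val v /\
  (x = val u \/ exists D, fine_partition_of delta (val u) x D)].
have Su : S (val u) by split; [rewrite lexx ltW|left].
have hS : has_sup S.
  by split; [exists (val u)|exists (val v) => x [/andP[]]].
pose s := sup S.
have us : val u <= s by exact: ub_le_sup (hS.2) _ Su.
have sv : s <= val v by apply: ge_sup; [exists (val u)|move=> x [/andP[]]].
pose s' : seg a b := exist _ s (mem_seg us sv).
have [x Sx sx] := sup_adherent (d0 s') hS.
have xs : x <= s by exact: ub_le_sup (hS.2) _ Sx.
have [/andP[ux xv] Px] := Sx.
pose x' : seg a b := exist _ x (mem_seg ux xv).
pose y := Num.min (val v) (s + delta s' / 2).
have sy : s <= y by rewrite le_min sv lerDl divr_ge0// ltW.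
have yv : y <= val v by rewrite ge_min lexx.
have uy : val u <= y by exact: le_trans sy.
pose y' : seg a b := exist _ y (mem_seg uy yv).
have ysd : y < s + delta s'.
  by rewrite gt_min ltrD2l ltr_pdivrMr// ltr_pMr// ltr1n orbT.
have Sy : S y.
  split; first by rewrite uy.
  have [xy|xy] := ltP x y; last first.
    by have -> : y = x by apply/eqP; rewrite eq_le xy (le_trans xs).
  have P2 : fine_partition_of delta x y [:: (x', y', s')].
    exact: (@fine_partition_of1 delta x' y' s').
  right; case: Px => [xu|[D P1]]; first by exists [:: (x', y', s')]; rewrite -xu.
  by exists (D ++ [:: (x', y', s')]); apply: fine_partition_of_cat P1 P2 => //; exact: ltW.
have ys : y <= s by exact: ub_le_sup (hS.2) _ Sy.
have yE : y = val v.
  have [vs|sv'] := leP (val v) (s + delta s' / 2); first exact: min_l.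
  by move: ys; rewrite {1}/y min_r ?(ltW sv')// gerDl leNgt divr_gt0// d0.
by move: Sy; rewrite yE => -[_ [vu|//]]; move: uv; rewrite vu ltxx.
Qed.

End Cousin.

(** * Lower bounds of Riemann sums by integrals *)

Section LowerSums.
Context {R : realType} {a b : R}.
Implicit Types (g h : seg a b -> R) (D : seq (@tagged_interval R a b)).
Local Notation mu := (@lebesgue_measure R).
Hypothesis ab : a < b.

Lemma exists_fine_partition (delta : seg a b -> R) : is_gauge delta ->
  exists D, fine_partition delta D.
Proof.
move=> d0.
have aab : a \in `[a, b] by rewrite in_itv /= lexx ltW.
have bab : b \in `[a, b] by rewrite in_itv /= lexx ltW.
have [D DP] := @cousin _ _ _ _ (exist _ a aab : seg a b) (exist _ b bab) d0 ab.
by exists D; exact: fine_partition_of_total.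
Qed.

Lemma measure_conull (D : set R) : @conull R a b D -> mu D = (b - a)%:E.
Proof.
move=> [mD Dab D0].
have <- : mu `[a, b]%classic = (b - a)%:E.
  by rewrite lebesgue_measure_itv/= lte_fin ab EFinB.
have mC : measurable (`[a, b]%classic `\` D).
  by apply: measurableD => //; exact: measurable_segment.
have disj : D `&` (`[a, b]%classic `\` D) = set0.
  by rewrite setDE setICA setICr setI0.
have := @measureU _ _ _ mu _ _ mD mC disj; rewrite setDUK// => ->.
by rewrite -[LHS]adde0; congr (_ + _)%E; exact: esym D0.
Qed.

(** The Riemann sums of the constant [c] are at least [c * (b - a)], so an upper bound for the sums
    of [c - h] turns into a lower bound for those of [g]. Off [D] the function [k] equals [c], which
    costs nothing as [D] is conull. *)
Lemma lower_sums_ge_bounded g (D : set R) (h : R -> R) c r : @conull R a b D ->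
  (forall t, 0 <= g t) -> measurable_fun D h -> (forall x, D x -> 0 <= h x <= c) ->
  (forall t : seg a b, D (val t) -> h (val t) <= g t) ->
  (r%:E < \int[mu]_(x in D) (h x)%:E)%E ->
  exists2 delta, is_gauge delta & forall D, fine_partition delta D ->
    r <= riemann_sum g D.
Proof.
move=> cD g0 mh h0c hg rh; have [mD Dab D0] := cD.
have Dx : exists x, D x.
  apply/not_existsP => D00; have := measure_conull cD.
  rewrite (_ : D = set0); last by apply/seteqP; split => x // /D00.
  by rewrite measure0 => -[] /eqP; rewrite eq_sym subr_eq0 gt_eqF.
have c0 : 0 <= c by have [x /h0c/andP[]] := Dx; exact: le_trans.
pose k (t : seg a b) : R := if val t \in D then c - h (val t) else c.
have split_int : (\int[mu]_(x in D) (h x)%:E + \int[mu]_(x in D) (c - h x)%:E =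
    (c * (b - a))%:E)%E.
  rewrite -ge0_integralD//; last 4 first.
  - by move=> x /h0c /andP[? _]; rewrite lee_fin.
  - exact/measurable_EFinP.
  - by move=> x /h0c /andP[_ ?]; rewrite lee_fin subr_ge0.
  - by apply/measurable_EFinP; exact: measurable_funB.
  rewrite EFinM -(measure_conull cD) -integral_cst//.
  by apply: eq_integral => x _; rewrite -EFinD addrC subrK.
have [delta dg De] : upper_sums_le k (c * (b - a) - r).
  apply: (@upper_sums_le_integral _ _ _ _ D (fun x => c - h x)) => //.
  - by move=> t; rewrite /k; case: ifPn => //; rewrite inE => /h0c/andP[_]; rewrite subr_ge0.
  - exact: measurable_funB.
  - by move=> x /h0c /andP[_]; rewrite subr_ge0.
  - by move=> t Dt; rewrite /k mem_set.
  rewrite EFinB -split_int.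
  have : (\int[mu]_(x in D) (h x)%:E + \int[mu]_(x in D) (c - h x)%:E)%E
      \is a fin_num by rewrite split_int.
  rewrite fin_numD => /andP[/fineK hE /fineK yE].
  by move: rh; rewrite -hE -yE -!EFinD !lte_fin => ?; lra.
exists delta => // D' fD; have tD := fD.1.
have := De _ fD; have : riemann_sum (fun=> c) D' <= riemann_sum g D' + riemann_sum k D'.
  rewrite -riemann_sumD; apply: riemann_sum_le => // t; rewrite /k.
  case: ifPn => [|_]; last by rewrite lerDr.
  by rewrite inE => Dt; have := hg _ Dt; lra.
rewrite /riemann_sum -mulr_sumr -/(riemann_sum g D') -/(riemann_sum k D').
have := ler_wpM2l c0 (sum_ti_len_ge ab tD); lra.
Qed.

(** Passing to the minimum of [h] and [n] restores boundedness; by monotone convergence some [n]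
    keeps the integral above [r]. *)
Lemma lower_sums_ge_integral g (D : set R) (h : R -> R) r : @conull R a b D ->
  (forall t, 0 <= g t) -> measurable_fun D h -> (forall x, D x -> 0 <= h x) ->
  (forall t : seg a b, D (val t) -> h (val t) <= g t) ->
  (r%:E < \int[mu]_(x in D) (h x)%:E)%E ->
  exists2 delta, is_gauge delta & forall D, fine_partition delta D ->
    r <= riemann_sum g D.
Proof.
move=> cD g0 mh h0 hg rh; have [mD Dab D0] := cD.
pose hn (n : nat) (x : R) := Num.min (h x) n%:R.
have mhn n : measurable_fun D (hn n).
  by apply: measurable_minr => //; exact: measurable_cst.
have [n rn] : exists n, (r%:E < \int[mu]_(x in D) (hn n x)%:E)%E.
  have := @cvg_monotone_convergence _ _ _ mu D mD (fun n x => (hn n x)%:E).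
  have -> : (fun x => limn (fun n => (hn n x)%:E)) = EFin \o h.
    apply/funext => x; apply/cvg_lim => //; apply/fine_cvgP; split.
      exact: nearW.
    apply: cvg_near_cst; exists (Num.truncn (h x)).+1 => // n /= xn.
    apply/min_l; apply/ltW; apply: (lt_le_trans (truncnS_gt _)).
    by rewrite ler_nat.
  move=> cv; apply/not_existsP => hnr; move: rh; rewrite ltNge => /negP; apply.
  have {}cv : (\int[mu]_(x in D) (hn n x)%:E)%E @[n --> \oo] -->
      (\int[mu]_(x in D) (h x)%:E)%E.
    apply: cv.
    - by move=> n; apply/measurable_EFinP; exact: (mhn n).
    - by move=> n x Dx; rewrite lee_fin /hn le_min (h0 _ Dx) ler0n.
    - by move=> x Dx n m nm; rewrite lee_fin /hn le_min !ge_min lexx/= ler_nat nm orbT.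
  rewrite -(cvg_lim _ cv)//; apply: lime_le; first by apply/cvg_ex; eexists; exact: cv.
  by apply: nearW => n; rewrite leNgt; apply/negP; exact: hnr.
apply: (@lower_sums_ge_bounded g D (hn n) n%:R r cD g0 (mhn n)) => //.
- by move=> x Dx; rewrite /hn le_min (h0 _ Dx) ler0n ge_min lexx orbT.
- by move=> t Dt; rewrite /hn ge_min (hg _ Dt).
Qed.

(** Otherwise some [r > e] lies below the integral, and a partition fine for both gauges, which
    exists by Cousin's lemma, has a Riemann sum at least [r] and at most [e]. *)
Lemma integral_le_upper_sums g (D : set R) (h : R -> R) e : @conull R a b D ->
  (forall t, 0 <= g t) -> measurable_fun D h -> (forall x, D x -> 0 <= h x) ->
  (forall t : seg a b, D (val t) -> h (val t) <= g t) ->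
  upper_sums_le g e -> (\int[mu]_(x in D) (h x)%:E <= e%:E)%E.
Proof.
move=> cD g0 mh h0 hg [d1 d1g ge]; rewrite leNgt; apply/negP => eh.
have [r er rh] : exists2 r, e < r & (r%:E < \int[mu]_(x in D) (h x)%:E)%E.
  move: eh; case: (\int[mu]_(x in D) _)%E => [I| |//].
    by rewrite lte_fin => eI; exists ((e + I) / 2); rewrite ?lte_fin; lra.
  by move=> _; exists (e + 1); rewrite ?ltrDl// ltry.
have [d2 d2g rg] := lower_sums_ge_integral cD g0 mh h0 hg rh.
have [D' /fine_partition_min[/ge fe /rg fr]] :=
  exists_fine_partition (is_gauge_min d1g d2g).
by have := lt_le_trans er (le_trans fr fe); rewrite ltxx.
Qed.

Lemma KH_integrable_lebesgue g (D : set R) (h : R -> R) : @conull R a b D ->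
  (forall t, 0 <= g t) -> measurable_fun D h ->
  (forall t : seg a b, D (val t) -> h (val t) = g t) ->
  (\int[mu]_(x in D) (h x)%:E < +oo)%E -> KH_integrable g.
Proof.
move=> cD g0 mh hg hoo; have [mD Dab D0] := cD.
have h0 x : D x -> 0 <= h x.
  by move=> Dx; rewrite (hg (exist _ x (Dab _ Dx)) Dx).
have I0 : (0 <= \int[mu]_(x in D) (h x)%:E)%E.
  by apply: integral_ge0 => x Dx; rewrite lee_fin h0.
have Ifin : (\int[mu]_(x in D) (h x)%:E)%E \is a fin_num by rewrite ge0_fin_numE.
exists (fine (\int[mu]_(x in D) (h x)%:E)%E) => e e0.
set I := fine _.
have [d1 d1g ge] : upper_sums_le g (I + e / 2).
  apply: (@upper_sums_le_integral _ _ _ _ D h) => //.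
    by move=> t Dt; rewrite hg.
  by rewrite -(fineK Ifin) lte_fin ltrDl divr_gt0.
have [d2 d2g rg] : exists2 delta : seg a b -> R, is_gauge delta &
    forall D, fine_partition delta D -> I - e / 2 <= riemann_sum g D.
  apply: (lower_sums_ge_integral cD g0 mh h0).
    by move=> t Dt; rewrite hg.
  by rewrite -(fineK Ifin) lte_fin ltrBlDr ltrDl divr_gt0.
exists (fun t => Num.min (d1 t) (d2 t)); first exact: is_gauge_min.
move=> D' /fine_partition_min[/ge fe /rg fr].
rewrite -/(riemann_sum g D') ltr_norml; apply/andP; split; lra.
Qed.

End LowerSums.

(** * Powers and seminorms *)

Section PowR.
Context {R : realType}.
Implicit Types (p x y d e : R).

Lemma powR_le p x y : 0 <= p -> 0 <= x -> x <= y -> x `^ p <= y `^ p.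
Proof.
by move=> p0 x0 xy; apply: ge0_ler_powR => //; rewrite nnegrE// (le_trans x0).
Qed.

(** The sum is at most twice the larger term. This crude constant replaces Minkowski's inequality
    throughout. *)
Lemma powRD_le p x y : 0 <= p -> 0 <= x -> 0 <= y ->
  (x + y) `^ p <= 2 `^ p * (x `^ p + y `^ p).
Proof.
move=> p0; wlog xy : x y / x <= y.
  move=> H x0 y0; have [/H|/ltW/H] := leP x y; first exact.
  by rewrite addrC [y `^ p + _]addrC; exact.
move=> x0 y0; apply: (@le_trans _ _ ((2 * y) `^ p)).
  by apply: powR_le; rewrite ?addr_ge0//; lra.
by rewrite powRM// ler_wpM2l ?powR_ge0// lerDr powR_ge0.
Qed.

(** When [x > e], the power of [x] with exponent [p - 1] is at least that of [e]. On a bounded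
    interval this converts smallness in p-mean into smallness in mean. *)
Lemma le_addM_powR p x e : 1 <= p -> 0 <= x -> 0 < e ->
  x <= e + e `^ (1 - p) * x `^ p.
Proof.
move=> p1 x0 e0; have [xe|ex] := leP x e.
  by rewrite (le_trans xe)// lerDl mulr_ge0 ?powR_ge0.
have x0' : 0 < x by exact: lt_trans ex.
apply: (@le_trans _ _ (e `^ (1 - p) * x `^ p)); last by rewrite lerDr ltW.
have -> : x `^ p = x `^ (p - 1) * x.
  have xn : x != 0 by rewrite gt_eqF.
  by rewrite -[X in _ * X]powRr1// -powRD ?xn ?implybT// subrK.
rewrite mulrA ler_peMl// -[1 - p]opprB powRN mulrC ler_pdivlMr ?powR_gt0//.
by rewrite mul1r powR_le ?subr_ge0// ltW.
Qed.

(** If [d] is small compared with [x], then [y] lies between [k2 * x] and [k1 * x], where [k1] and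
    [k2] are the p-th roots of [1 + e] and [1 - e], and the term in [e] suffices. Otherwise [x] and
    [y] are both at most [K * d]. *)
Lemma powR_dist_le p e : 1 <= p -> 0 < e -> exists2 C : R, 0 <= C &
  forall x y d, 0 <= x -> 0 <= y -> `|x - y| <= d ->
    `|x `^ p - y `^ p| <= e * x `^ p + C * d `^ p.
Proof.
(* With [e < 1] the number [1 - e] is positive and has a p-th root. *)
move=> p1; wlog e1 : e / e < 1.
  move=> H e0; have m1 : Num.min e (1 / 2) < 1 by rewrite gt_min; apply/orP; right; lra.
  have m0 : 0 < Num.min e (1 / 2) by rewrite lt_min e0/=; lra.
  have [C C0 HC] := H _ m1 m0.
  exists C => // x y d x0 y0 xyd; apply: (le_trans (HC _ _ _ x0 y0 xyd)).
  by rewrite lerD2r ler_wpM2r ?powR_ge0// ge_min lexx.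
move=> e0; have p0 : 0 < p by lra.
have powK (z : R) : 0 <= z -> (z `^ p^-1) `^ p = z.
  by move=> z0; rewrite -powRrM mulVf ?gt_eqF// powRr1.
pose k1 := (1 + e) `^ p^-1; pose k2 := (1 - e) `^ p^-1.
have k1P : k1 `^ p = 1 + e by rewrite powK//; lra.
have k2P : k2 `^ p = 1 - e by rewrite powK//; lra.
have k20 : 0 <= k2 by exact: powR_ge0.
have k11 : 1 < k1.
  rewrite ltNge; apply/negP => /(powR_le (ltW p0)); rewrite powR_ge0 => /(_ isT).
  by rewrite k1P powR1 gerDl leNgt e0.
have k21 : k2 < 1.
  rewrite ltNge; apply/negP => /(powR_le (ltW p0)); rewrite ler01 => /(_ isT).
  by rewrite k2P powR1 lerDl oppr_ge0 leNgt e0.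
clearbody k1 k2; pose k := Num.min (k1 - 1) (1 - k2).
have k0 : 0 < k by rewrite lt_min !subr_gt0 k11.
pose K := 1 + k^-1.
have K0 : 0 < K by rewrite addr_gt0 ?invr_gt0.
exists (K `^ p); first exact: powR_ge0.
move=> x y d x0 y0 xyd; have d0 : 0 <= d by exact: le_trans xyd.
have [dx|xd] := leP d (k * x).
  have dx1 : d <= (k1 - 1) * x by rewrite (le_trans dx)// ler_wpM2r// ge_min lexx.
  have dx2 : d <= (1 - k2) * x by rewrite (le_trans dx)// ler_wpM2r// ge_min lexx orbT.
  move: xyd; rewrite ler_norml => /andP[xyd1 xyd2].
  have yk1 : y <= k1 * x by clear -xyd1 dx1; lra.
  have yk2 : k2 * x <= y by clear -xyd2 dx2; lra.
  have y1 : y `^ p <= (1 + e) * x `^ p.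
    rewrite -k1P -powRM //; last exact: ltW (lt_trans ltr01 k11).
    by apply: powR_le => //; exact: ltW.
  have y2 : (1 - e) * x `^ p <= y `^ p.
    rewrite -k2P -powRM//.
    by apply: powR_le => //; [exact: ltW|exact: mulr_ge0].
  have Kd0 := mulr_ge0 (powR_ge0 K p) (powR_ge0 d p).
  rewrite ler_norml; move: y1 y2 Kd0; clear; set xp := x `^ p; set yp := y `^ p.
  by set Kd := (_ * _ `^ p) => *; apply/andP; split; lra.
have xKd : x <= k^-1 * d by rewrite ler_pdivlMl// ltW.
have kd : 0 <= k^-1 * d by rewrite mulr_ge0// invr_ge0 ltW.
have Kd : K * d = d + k^-1 * d by rewrite mulrDl mul1r.
move: xyd; rewrite ler_norml => /andP[xyd1 xyd2].
have xK : x <= K * d by clear -xKd d0 Kd; lra.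
have yK : y <= K * d by clear -xKd xyd1 Kd; lra.
have x1 : x `^ p <= K `^ p * d `^ p.
  by rewrite -powRM// ?(ltW K0)//; apply: powR_le => //; exact: ltW.
have y1 : y `^ p <= K `^ p * d `^ p.
  by rewrite -powRM// ?(ltW K0)//; apply: powR_le => //; exact: ltW.
have xp0 := powR_ge0 x p; have yp0 := powR_ge0 y p.
have exp0 := mulr_ge0 (ltW e0) xp0.
rewrite ler_norml; move: x1 y1 xp0 yp0 exp0; clear.
move: (x `^ p) (y `^ p) (K `^ p * d `^ p) => xp yp Kdp.
by move: (e * xp) => exp *; apply/andP; split; lra.
Qed.

End PowR.

Section SemiNormTheory.
Context {R : realType} {X : lmodType R} (rho : X -> R).
Hypothesis rhoP : seminorm rho.

Lemma seminorm0 : rho 0 = 0.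
Proof. by rewrite -(scale0r (0 : X)) (seminormZ rhoP) normr0 mul0r. Qed.

Lemma seminormN u : rho (- u) = rho u.
Proof. by rewrite -scaleN1r (seminormZ rhoP) normrN1 mul1r. Qed.

Lemma seminorm_ge0 u : 0 <= rho u.
Proof.
have := seminormD rhoP u (- u); rewrite subrr seminorm0 seminormN; lra.
Qed.

Lemma seminormBC u v : rho (u - v) = rho (v - u).
Proof. by rewrite -seminormN opprB. Qed.

Lemma seminorm_triangle w u v : rho (u - v) <= rho (u - w) + rho (w - v).
Proof. by rewrite (le_trans _ (seminormD rhoP _ _))// addrA subrK. Qed.

Lemma seminorm_dist u v : `|rho u - rho v| <= rho (u - v).
Proof.
have := seminormD rhoP (u - v) v; have := seminormD rhoP (v - u) u.
by rewrite !subrK (seminormBC v) ler_norml => ? ?; apply/andP; split; lra.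
Qed.

End SemiNormTheory.

(** * Simple functions *)

Section SimpleFunctions.
Context {R : realType} {X : lmodType R}.
Local Notation mu := (@lebesgue_measure R).
Implicit Types (s : seq (set R * X)) (A E : set R).

(* A list of pairs (E, z) stands for the simple function [sum 1_E z]. *)
Definition simple_fun s (x : R) : X := \sum_(c <- s) (\1_(c.1) x : R) *: c.2.

(** Meant for [A] of finite measure, since [fine] sends an infinite measure to 0. *)
Definition simple_int s A : X := \sum_(c <- s) fine (mu (c.1 `&` A)) *: c.2.

Definition simple_measurable s := forall c, c \in s -> measurable c.1.

Definition simple_scale (k : R) s := [seq (c.1, k *: c.2) | c <- s].

Lemma simple_fun_cat s s' x :
  simple_fun (s ++ s') x = simple_fun s x + simple_fun s' x.
Proof. by rewrite /simple_fun big_cat. Qed.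

Lemma simple_int_cat s s' A :
  simple_int (s ++ s') A = simple_int s A + simple_int s' A.
Proof. by rewrite /simple_int big_cat. Qed.

Lemma simple_fun_scale k s x : simple_fun (simple_scale k s) x = k *: simple_fun s x.
Proof.
rewrite /simple_fun big_map scaler_sumr; apply: eq_bigr => c _ /=.
by rewrite !scalerA mulrC.
Qed.

Lemma simple_int_scale k s A : simple_int (simple_scale k s) A = k *: simple_int s A.
Proof.
rewrite /simple_int big_map scaler_sumr; apply: eq_bigr => c _ /=.
by rewrite !scalerA mulrC.
Qed.

Lemma simple_measurable_cat s s' : simple_measurable s -> simple_measurable s' ->
  simple_measurable (s ++ s').
Proof. by move=> ms ms' c; rewrite mem_cat => /orP[/ms|/ms']. Qed.

Lemma simple_measurable_scale k s : simple_measurable s ->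
  simple_measurable (simple_scale k s).
Proof. by move=> ms c /mapP[c' /ms ? ->]. Qed.

Lemma simple_measurable_cons E z s : simple_measurable ((E, z) :: s) ->
  measurable E /\ simple_measurable s.
Proof.
move=> ms; split; first by apply: (ms (E, z)); rewrite mem_head.
by move=> c cs; apply: ms; rewrite inE cs orbT.
Qed.

Lemma simple_fun_cons E z s x :
  simple_fun ((E, z) :: s) x = (if x \in E then z else 0) + simple_fun s x.
Proof.
rewrite /simple_fun big_cons indicE; case: (x \in E); first by rewrite scale1r.
by rewrite scale0r.
Qed.

Lemma simple_int_cons E z s A :
  simple_int ((E, z) :: s) A = fine (mu (E `&` A)) *: z + simple_int s A.
Proof. by rewrite /simple_int big_cons. Qed.

Variable rho : X -> R.
Hypothesis rhoP : seminorm rho.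

(** By induction on the list: on [E] the value [z] is absorbed in the offset, so the function is a
    choice between two measurable real functions. *)
Lemma measurable_seminorm_simple s y (D : set R) : simple_measurable s ->
  measurable_fun D (fun x => rho (y + simple_fun s x)).
Proof.
move=> ms; suff : measurable_fun setT (fun x => rho (y + simple_fun s x)).
  by apply: measurable_funS.
elim: s y ms => [|[E z] s IH] y ms.
  by under eq_fun do rewrite /simple_fun big_nil; exact: measurable_cst.
have [mE {}ms] := simple_measurable_cons ms.
under eq_fun => x.
  rewrite simple_fun_cons (_ : y + _ =
    if x \in E then (y + z) + simple_fun s x else y + simple_fun s x); last first.
    by case: ifP; rewrite ?add0r ?addrA.
  rewrite (fun_if rho); over.
apply: measurable_fun_ifT; [|exact: IH|exact: IH].
apply: (measurable_fun_bool true); rewrite setTI.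
rewrite (_ : _ @^-1` _ = E)//; apply/seteqP; split => x /=; [exact: set_mem|exact: mem_set].
Qed.

Lemma measurable_seminorm_simple0 s (D : set R) : simple_measurable s ->
  measurable_fun D (fun x => rho (simple_fun s x)).
Proof.
move=> ms; have := @measurable_seminorm_simple s 0 D ms.
by congr (measurable_fun D _); apply/funext => x; rewrite add0r.
Qed.

Lemma simple_fun_bounded s : exists2 M : R, 0 <= M & forall x, rho (simple_fun s x) <= M.
Proof.
elim: s => [|[E z] s [M M0 HM]].
  by exists 0 => // x; rewrite /simple_fun big_nil (seminorm0 rhoP).
exists (rho z + M); first by rewrite addr_ge0 ?(seminorm_ge0 rhoP).
move=> x; rewrite simple_fun_cons (le_trans (seminormD rhoP _ _))// lerD//.
by case: ifP => // _; rewrite (seminorm0 rhoP) (seminorm_ge0 rhoP).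
Qed.

Lemma fine_measureD A B : measurable A -> measurable B -> A `&` B = set0 ->
  (mu A < +oo)%E -> (mu B < +oo)%E ->
  fine (mu (A `|` B)) = fine (mu A) + fine (mu B).
Proof.
by move=> mA mB AB Aoo Boo; rewrite measureU// fineD// ge0_fin_numE.
Qed.

Lemma simple_intD s A B : simple_measurable s -> measurable A -> measurable B ->
  A `&` B = set0 -> (mu A < +oo)%E -> (mu B < +oo)%E ->
  simple_int s (A `|` B) = simple_int s A + simple_int s B.
Proof.
move=> + mA mB AB Aoo Boo; elim: s => [|[E z] s IH] ms.
  by rewrite /simple_int !big_nil addr0.
have [mE {}ms] := simple_measurable_cons ms.
have small C : measurable C -> (mu C < +oo)%E -> (mu (E `&` C) < +oo)%E.
  move=> mC; apply: le_lt_trans; apply: le_measure; rewrite ?inE//.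
  exact: measurableI.
rewrite !simple_int_cons IH// setIUr fine_measureD ?scalerDl ?small//; last 3 first.
- exact: measurableI.
- exact: measurableI.
- by rewrite setIACA AB setI0.
by rewrite -!addrA; congr (_ + _); rewrite addrCA.
Qed.

(* The offset [y] makes the statement provable by induction on the list. *)
Lemma seminorm_simple_int_le s A y : simple_measurable s -> measurable A ->
  (mu A < +oo)%E ->
  ((rho (fine (mu A) *: y + simple_int s A))%:E <=
   \int[mu]_(x in A) (rho (y + simple_fun s x))%:E)%E.
Proof.
elim: s A y => [|[E z] s IH] A y ms mA Aoo.
  rewrite /simple_int big_nil addr0 (seminormZ rhoP) ger0_norm ?fine_ge0//.
  under eq_integral do rewrite /simple_fun big_nil addr0.
  by rewrite integral_cst// EFinM fineK ?ge0_fin_numE// muleC.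
have [mE {}ms] := simple_measurable_cons ms.
have mAE : measurable (A `&` E) by exact: measurableI.
have mAD : measurable (A `\` E) by exact: measurableD.
have Asplit : A = (A `&` E) `|` (A `\` E) by rewrite setUIDK.
have disj : (A `&` E) `&` (A `\` E) = set0.
  by apply/seteqP; split => x // -[[_ Ex] [_ /(_ Ex)]].
have AEoo : (mu (A `&` E) < +oo)%E.
  by apply: le_lt_trans Aoo; apply: le_measure; rewrite ?inE//; exact: subIsetl.
have ADoo : (mu (A `\` E) < +oo)%E.
  by apply: le_lt_trans Aoo; apply: le_measure; rewrite ?inE//; exact: subDsetl.
have mrho t y' (D : set R) : simple_measurable t ->
    measurable_fun D (fun x => (rho (y' + simple_fun t x))%:E).
  by move=> mt; apply/measurable_EFinP; exact: measurable_seminorm_simple.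
have ms' : simple_measurable ((E, z) :: s).
  by move=> c; rewrite inE => /predU1P[->|/ms].
have intsplit : (\int[mu]_(x in A) (rho (y + simple_fun ((E, z) :: s) x))%:E =
    \int[mu]_(x in A `&` E) (rho ((y + z) + simple_fun s x))%:E +
    \int[mu]_(x in A `\` E) (rho (y + simple_fun s x))%:E)%E.
  rewrite [in LHS]Asplit ge0_integral_setU//; last 3 first.
  - exact: mrho.
  - by move=> x _; rewrite lee_fin seminorm_ge0.
  - exact/eqP.
  congr (_ + _)%E; apply: eq_integral => x; rewrite inE => -[Ax Ex].
    by rewrite simple_fun_cons mem_set// addrA.
  by rewrite simple_fun_cons memNset// add0r.
have -> : fine (mu A) *: y + simple_int ((E, z) :: s) A =
    (fine (mu (A `&` E)) *: (y + z) + simple_int s (A `&` E)) +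
    (fine (mu (A `\` E)) *: y + simple_int s (A `\` E)).
  have -> : fine (mu A) = fine (mu (A `&` E)) + fine (mu (A `\` E)).
    by rewrite -fine_measureD// -Asplit.
  rewrite simple_int_cons [E `&` A]setIC.
  have -> : simple_int s A = simple_int s (A `&` E) + simple_int s (A `\` E).
    by rewrite -simple_intD// -Asplit.
  rewrite scalerDl scalerDr -!addrA; congr (_ + _).
  by rewrite [LHS]addrCA [X in _ = _ + X]addrCA.
rewrite intsplit (@le_trans _ _ ((rho (fine (mu (A `&` E)) *: (y + z) +
    simple_int s (A `&` E)))%:E + (rho (fine (mu (A `\` E)) *: y +
    simple_int s (A `\` E)))%:E)%E)//.
  by rewrite -EFinD lee_fin seminormD.
by rewrite leeD// IH.
Qed.

End SimpleFunctions.

(** * SKH primitives of simple functions and of their limits *)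

Section SKHPrimitive.
Context {R : realType} {X : lmodType R} {a b : R}.
Variable rho : X -> R.
Hypothesis rhoP : seminorm rho.
Local Notation mu := (@lebesgue_measure R).
Implicit Types (f F g G : seg a b -> X) (s : seq (set R * X)).

Definition SKH_primitive f F := forall e : R, 0 < e ->
  exists2 delta, is_gauge delta & forall D, fine_partition delta D ->
    \sum_(J <- D)
      rho (F (ti_hi J) - F (ti_lo J) - ti_len J *: f (ti_tag J)) < e.

Lemma SKH_primitive_lin c f F g G : SKH_primitive f F -> SKH_primitive g G ->
  SKH_primitive (fun t => c *: f t + g t) (fun t => c *: F t + G t).
Proof.
move=> fF gG e e0; have c0 : 0 < `|c| + 1 by rewrite ltr_wpDl.
have [|d1 d1g D1] := fF (e / 2 / (`|c| + 1)); first by rewrite !divr_gt0.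
have [|d2 d2g D2] := gG (e / 2); first by rewrite divr_gt0.
exists (fun t => Num.min (d1 t) (d2 t)); first exact: is_gauge_min.
move=> D /fine_partition_min[/D1 H1 /D2 H2].
pose d (f : seg a b -> X) (F : seg a b -> X) (J : @tagged_interval R a b) : X :=
  F (ti_hi J) - F (ti_lo J) - ti_len J *: f (ti_tag J).
apply: (@le_lt_trans _ _ (\sum_(J <- D) (`|c| * rho (d f F J) + rho (d g G J)))).
  apply: ler_sum => J _; rewrite -(seminormZ rhoP).
  rewrite (le_trans _ (seminormD rhoP _ _))// le_eqVlt; apply/orP; left; apply/eqP.
  congr rho; rewrite /d !scalerBr scalerDr !scalerA [c * _]mulrC !opprD.
  by rewrite [X in X + _ = _]addrACA [LHS]addrACA.
rewrite big_split -mulr_sumr/=.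
have : `|c| * (\sum_(J <- D) rho (d f F J)) <= e / 2.
  apply: (@le_trans _ _ ((`|c| + 1) * (e / 2 / (`|c| + 1)))).
    apply: ler_pM; rewrite ?lerDl ?sumr_ge0//; last exact: ltW.
    by move=> J _; exact: seminorm_ge0.
  by rewrite mulrC divfK// gt_eqF.
move: H2; rewrite -/(d g G) => H2 Hc.
have : \sum_(J <- D) rho (d g G J) < e / 2 by [].
lra.
Qed.

Lemma SKH_primitive0 : SKH_primitive (fun=> 0) (fun=> 0).
Proof.
move=> e e0; exists (fun=> 1) => // D _.
by rewrite big1// => J _; rewrite scaler0 !subr0 (seminorm0 rhoP).
Qed.

Definition simple_prim s (t : seg a b) : X := simple_int s `[a, val t[%classic.

Lemma measure_sub_segment_lty (A : set R) : measurable A -> A `<=` `[a, b]%classic ->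
  (mu A < +oo)%E.
Proof.
move=> mA Aab; apply: (@le_lt_trans _ _ (mu `[a, b]%classic)).
  by apply: le_measure; rewrite ?inE; [exact: mA|exact: measurable_segment|exact: Aab].
by rewrite lebesgue_measure_itv/=; case: ifP => _; rewrite -?EFinB ltry.
Qed.

Lemma co_seg_sub (u v : seg a b) : `[val u, val v[%classic `<=` `[a, b]%classic.
Proof.
move=> x /=; rewrite !in_itv /= => /andP[ux xv].
have /andP[au _] := seg_itv u; have /andP[_ vb] := seg_itv v.
by rewrite (le_trans au ux) (ltW (lt_le_trans xv vb)).
Qed.

Lemma simple_primB s (u v : seg a b) : simple_measurable s -> val u <= val v ->
  simple_prim s v - simple_prim s u = simple_int s `[val u, val v[%classic.
Proof.
move=> ms uv; have /andP[au ub] := seg_itv u; have /andP[av vb] := seg_itv v.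
have itvE : `[a, val v[%classic = `[a, val u[%classic `|` `[val u, val v[%classic.
  by rewrite -itv_bndbnd_setU// bnd_simp.
have ab : a <= b by exact: le_trans ub.
have aab : a \in `[a, b] by rewrite in_itv /= lexx.
have fin (w : seg a b) (x : seg a b) : (mu `[val w, val x[%classic < +oo)%E.
  by apply: measure_sub_segment_lty; [exact: measurable_itv|exact: co_seg_sub].
rewrite /simple_prim itvE simple_intD//.
- by rewrite addrC addKr.
- by apply/seteqP; split => x //=; rewrite !in_itv /= => -[/andP[_ xu] /andP[ux _]];
    have := lt_le_trans xu ux; rewrite ltxx.
- exact: (fin (exist _ a aab)).
Qed.

(** The gauge keeps intervals tagged in [E] inside an open [U] around [E], the others inside an open
    [V] around its complement. The error on an interval is [rho z] times the measure of the part on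
    the wrong side of its tag, which lies in the small set [W]. *)
Lemma SKH_primitive_indic (E : set R) z : measurable E ->
  SKH_primitive (fun t => (\1_E (val t) : R) *: z)
    (fun t => fine (mu (E `&` `[a, val t[%classic)) *: z).
Proof.
(* [W] has measure at most [r + r], so the total error is at most two thirds of [e]; adding 1 to
   [rho z] avoids a zero divisor. *)
move=> mE e e0; pose r := e / 3 / (rho z + 1).
have z0 : 0 < rho z + 1 by rewrite ltr_wpDl ?(seminorm_ge0 rhoP).
have r0 : 0 < r by rewrite !divr_gt0.
have mab := @measurable_segment R a b.
have mEI : measurable (E `&` `[a, b]%classic) by exact: measurableI.
have mED : measurable (`[a, b]%classic `\` E) by exact: measurableD.
have [U [oU EU Ur]] := lebesgue_regularity_outer mEI
  (measure_sub_segment_lty mEI (@subIsetr _ _ _)) r0.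
have [V [oV EV Vr]] := lebesgue_regularity_outer mED
  (measure_sub_segment_lty mED (@subDsetl _ _ _)) r0.
have mU : measurable U by exact: open_measurable.
have mV : measurable V by exact: open_measurable.
pose W := (U `\` (E `&` `[a, b]%classic)) `|` (V `\` (`[a, b]%classic `\` E)).
have mW : measurable W by apply: measurableU; apply: measurableD.
have /choice[d dP] : forall t : seg a b, exists d : R, 0 < d /\
    forall x, `|x - val t| < d -> if val t \in E then U x else V x.
  move=> t; case: (boolP (val t \in E)) => tE.
    have Ut : U (val t) by apply: EU; split; [exact: set_mem|exact: valP].
    have /nbhs_ballP[d /= d0 dU] := open_nbhs_nbhs (conj oU Ut).
    by exists d; split => // x xd; apply: dU; rewrite /ball/= distrC.
  have Vt : V (val t).
    by apply: EV; split; [exact: valP|move=> Et; move: tE; rewrite mem_set].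
  have /nbhs_ballP[d /= d0 dV] := open_nbhs_nbhs (conj oV Vt).
  by exists d; split => // x xd; apply: dV; rewrite /ball/= distrC.
exists d => [t|D [tD fD]]; first by case: (dP t).
have JW J : J \in D -> ((rho (fine (mu (E `&` `[a, val (ti_hi J)[%classic)) *: z -
      fine (mu (E `&` `[a, val (ti_lo J)[%classic)) *: z -
      ti_len J *: ((\1_E (val (ti_tag J)) : R) *: z)))%:E <=
    (rho z)%:E * \int[mu]_(x in co_itv J) (\1_W x)%:E)%E.
  move=> JD. have mJ := @measurable_co_itv R a b J.
  have Jab := co_itv_sub tD JD.
  have mEJ : measurable (E `&` co_itv J) by exact: measurableI.
  have finJ A : measurable A -> mu (A `&` co_itv J) \is a fin_num.
    move=> mA; rewrite ge0_fin_numE//; apply: measure_sub_segment_lty.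
      exact: measurableI.
    by move=> x [_ /Jab].
  have prim := @simple_primB [:: (E, z)] (ti_lo J) (ti_hi J).
  rewrite /simple_prim /simple_int !big_seq1 in prim; rewrite prim; last 2 first.
  - by move=> c; rewrite inE => /eqP->.
  - exact/ltW/(tp_nondegenerate tD).
  rewrite -/(co_itv J) scalerA -scalerBl (seminormZ rhoP) EFinM muleC.
  rewrite lee_wpmul2l ?lee_fin ?(seminorm_ge0 rhoP)//.
  rewrite integral_indic//; have [_ dJ] := dP (ti_tag J).
  have dist x : co_itv J x -> `|x - val (ti_tag J)| < d (ti_tag J).
    move=> Jx; have : `[val (ti_lo J), val (ti_hi J)]%classic x.
      by move: Jx; rewrite /co_itv /= !in_itv /= => /andP[-> /ltW->].
    by move=> /(fD J JD); rewrite /= in_itv /= -ltr_distlC distrC.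
  rewrite indicE; have [tE|tE] := boolP (val (ti_tag J) \in E); last first.
    rewrite mulr0 subr0 ger0_norm ?fine_ge0// fineK ?finJ//.
    apply: le_measure; rewrite ?inE//; first exact: measurableI.
    move=> x [Ex Jx]; split => //; right; split; last by case.
    by have := dJ _ (dist _ Jx); rewrite (negbTE tE).
  have -> : ti_len J = fine (mu (E `&` co_itv J)) + fine (mu (~` E `&` co_itv J)).
    rewrite -fineD ?finJ//; last exact: measurableC.
    rewrite -measureU//; last 2 first.
    - by apply: measurableI => //; exact: measurableC.
    - by rewrite setIACA setICr set0I.
    rewrite -setIUl setUCr setTI.
    exact: (esym (congr1 fine (co_itv_measure tD JD))).
  rewrite mulr1 opprD addrA subrr sub0r normrN ger0_norm ?fine_ge0//.
  rewrite fineK ?finJ//; last exact: measurableC.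
  apply: le_measure; rewrite ?inE//.
  - by apply: measurableI => //; exact: measurableC.
  - exact: measurableI.
  - move=> x [Ex Jx]; split => //; left; split; last by case.
    by have := dJ _ (dist _ Jx); rewrite tE.
rewrite -lte_fin -sumEFin big_seq.
apply: (@le_lt_trans _ _ (\sum_(J <- D)
    (rho z)%:E * \int[mu]_(x in co_itv J) (\1_W x)%:E)%E).
  by rewrite [leRHS]big_seq; exact: lee_sum.
have I0 (A : set R) : (0 <= \int[mu]_(x in A) (\1_W x)%:E)%E.
  by apply: integral_ge0 => x _; rewrite lee_fin.
rewrite -ge0_sume_distrr//.
apply: (@le_lt_trans _ _ ((rho z)%:E * (r + r)%:E)%E); last first.
  rewrite -EFinM lte_fin; apply: (@le_lt_trans _ _ ((rho z + 1) * (r + r))).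
    by rewrite ler_wpM2r ?addr_ge0 ?(ltW r0)// lerDl.
  rewrite mulrDr [_ * r]mulrC divfK ?gt_eqF//; lra.
rewrite lee_wpmul2l ?lee_fin ?(seminorm_ge0 rhoP)//.
apply: le_trans (sum_integral_co_itv_le tD _ _) _.
- by apply/measurable_EFinP; exact: measurable_indic.
- by move=> x _; rewrite lee_fin.
rewrite integral_indic// (@le_trans _ _ (mu W))//.
  by apply: le_measure; rewrite ?inE; [exact: measurableI|exact: mW|exact: subIsetl].
rewrite EFinD (le_trans (measureU2 mu _ _))//; last by rewrite leeD// ltW.
- exact: measurableD.
- exact: measurableD.
Qed.

Lemma SKH_primitive_simple s : simple_measurable s ->
  SKH_primitive (fun t => simple_fun s (val t)) (simple_prim s).
Proof.
elim: s => [|[E z] s IH] ms.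
  rewrite (_ : (fun t => _) = (fun=> 0)); last first.
    by apply/funext => t; rewrite /simple_fun big_nil.
  rewrite (_ : simple_prim _ = (fun=> 0)); first exact: SKH_primitive0.
  by apply/funext => t; rewrite /simple_prim /simple_int big_nil.
have [mE {}ms] := simple_measurable_cons ms.
have := SKH_primitive_lin 1 (SKH_primitive_indic z mE) (IH ms).
rewrite (_ : (fun t => 1 *: _ + _) = (fun t => simple_fun ((E, z) :: s) (val t))).
  rewrite (_ : (fun t => 1 *: _ + _) = simple_prim ((E, z) :: s))//.
  by apply/funext => t; rewrite scale1r /simple_prim simple_int_cons.
by apply/funext => t; rewrite scale1r /simple_fun big_cons.
Qed.

(** The primitives of the approximants are Cauchy at each point, and completeness gives [F].
    Pointwise convergence suffices: the gauge depends on [n] alone, and a second index [m] is chosen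
    after the partition, to be good at its finitely many endpoints. *)
Lemma SKH_limit f : sequentially_complete rho -> a < b ->
  (forall e : R, 0 < e -> exists2 s, simple_measurable s &
    upper_sums_le (fun t => rho (f t - simple_fun s (val t))) e) ->
  SKH_integrable rho f.
Proof.
move=> complete ab approx.
have /choice[s sP] : forall n : nat, exists s, simple_measurable s /\
    upper_sums_le (fun t => rho (f t - simple_fun s (val t))) n.+1%:R^-1.
  move=> n; have [|s ms se] := approx n.+1%:R^-1; first by rewrite invr_gt0.
  by exists s.
have ms n : simple_measurable (s n) by case: (sP n).
pose diff n m := s m ++ simple_scale (-1) (s n).
have mdiff n m : simple_measurable (diff n m).
  by apply: simple_measurable_cat => //; exact: simple_measurable_scale.
have diffE n m x : simple_fun (diff n m) x = simple_fun (s m) x - simple_fun (s n) x.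
  by rewrite simple_fun_cat simple_fun_scale scaleN1r.
pose e n : R := n.+1%:R^-1.
have mdiffrho n m (D : set R) : measurable_fun D (fun x => rho (simple_fun (diff n m) x)).
  exact: measurable_seminorm_simple0.
have conull_ab : @conull R a b `[a, b]%classic.
  by split; [exact: measurable_segment|exact: subset_refl|rewrite setDv measure0].
have int_le n m : (\int[mu]_(x in `[a, b]) (rho (simple_fun (diff n m) x))%:E <=
    (e n + e m)%:E)%E.
  apply: (@integral_le_upper_sums _ _ _ ab
      (fun t => rho (f t - simple_fun (s n) (val t)) +
                rho (f t - simple_fun (s m) (val t)))) => //.
  - by move=> t; rewrite addr_ge0 ?seminorm_ge0.
  - by move=> x _; exact: seminorm_ge0.
  - move=> t _; rewrite diffE (le_trans (seminorm_triangle rhoP (f t) _ _))//.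
    by rewrite addrC lerD2l (seminormBC rhoP).
  - by apply: upper_sums_leD; [exact: (sP n).2|exact: (sP m).2].
pose H n := simple_prim (s n) : seg a b -> X.
have int_itv n m (u v : seg a b) : val u <= val v ->
    ((rho (simple_int (diff n m) `[val u, val v[%classic))%:E <=
    \int[mu]_(x in `[val u, val v[) (rho (simple_fun (diff n m) x))%:E)%E.
  move=> uv; have := @seminorm_simple_int_le _ _ _ rhoP _ `[val u, val v[%classic 0
    (mdiff n m).
  rewrite scaler0 add0r; under eq_integral do rewrite add0r; apply.
    exact: measurable_itv.
  by apply: measure_sub_segment_lty; [exact: measurable_itv|exact: co_seg_sub].
have simple_int_diff n m (A : set R) :
    simple_int (diff n m) A = simple_int (s m) A - simple_int (s n) A.
  by rewrite simple_int_cat simple_int_scale scaleN1r.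
have e_gt0 n : 0 < e n by rewrite invr_gt0.
have e_le n m : (n <= m)%N -> e m <= e n.
  by move=> nm; rewrite lef_pV2 ?posrE// ler_nat.
have e_small r : 0 < r -> exists n, e n < r.
  move=> r0; exists (Num.truncn r^-1); rewrite invf_plt ?posrE//.
  exact: truncnS_gt.
have aab : a \in `[a, b] by rewrite in_itv /= lexx ltW.
have Hdist n m t : rho (H m t - H n t) <= e n + e m.
  rewrite /H /simple_prim -simple_int_diff -lee_fin.
  have /andP[ta _] := seg_itv t.
  apply: le_trans (int_le n m).
  apply: le_trans (@int_itv n m (exist _ a aab) t ta) _.
  apply: ge0_subset_integral => //.
  - by apply/measurable_EFinP; exact: mdiffrho.
  - by move=> x _; rewrite lee_fin seminorm_ge0.
  - exact: (@co_seg_sub (exist _ a aab) t).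
have /choice[F FP] : forall t, exists l, sn_converges_to rho (H^~ t) l.
  move=> t; apply: complete => r r0.
  have [|N Nr] := e_small (r / 2); first by rewrite divr_gt0.
  exists N => m n Nm Nn; apply: (le_lt_trans (Hdist n m t)).
  by have := e_le _ _ Nm; have := e_le _ _ Nn; lra.
exists F => r r0.
(* Five shares of [e n]: the primitive of [s n], the upper sum of the distance from [f] to [s n],
   the endpoints, and [e n + e m], at most twice [e n], for the distance between primitives. *)
have [|n nr] := e_small (r / 5); first by rewrite divr_gt0.
have [d1 d1g D1] := SKH_primitive_simple (ms n) (e_gt0 n).
have [d2 d2g D2] := (sP n).2.
exists (fun t => Num.min (d1 t) (d2 t)); first exact: is_gauge_min.
move=> D /fine_partition_min[fD1 /D2 H2]; have tD := fD1.1.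
have {D1}H1 := D1 _ fD1.
have [m nm Fm] : exists2 m, (n <= m)%N & \sum_(J <- D)
    (rho (H m (ti_hi J) - F (ti_hi J)) + rho (H m (ti_lo J) - F (ti_lo J))) < e n.
  suff [N HN] : exists N, forall m, (N <= m)%N -> \sum_(J <- D)
    (rho (H m (ti_hi J) - F (ti_hi J)) + rho (H m (ti_lo J) - F (ti_lo J))) < e n.
    by exists (maxn n N); [exact: leq_maxl|apply: HN; exact: leq_maxr].
  elim: D {tD H1 H2 fD1} (e n) (e_gt0 n) => [|J D IH] q q0.
    by exists 0%N => m _; rewrite big_nil.
  have [|N1 HN1] := FP (ti_hi J) (q / 3); first by rewrite divr_gt0.
  have [|N2 HN2] := FP (ti_lo J) (q / 3); first by rewrite divr_gt0.
  have [|N3 HN3] := IH (q / 3); first by rewrite divr_gt0.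
  exists (maxn N1 (maxn N2 N3)) => m; rewrite !geq_max => /and3P[m1 m2 m3].
  rewrite big_cons; have := HN1 _ m1; have := HN2 _ m2; have := HN3 _ m3.
  lra.
have Hnm : \sum_(J <- D) rho (simple_int (diff n m) (co_itv J)) <= e n + e m.
  rewrite -lee_fin -sumEFin; apply: le_trans (int_le n m).
  apply: le_trans (sum_integral_co_itv_le tD _ _); last 2 first.
  - by apply/measurable_EFinP; exact: mdiffrho.
  - by move=> x _; rewrite lee_fin seminorm_ge0.
  rewrite big_seq [leRHS]big_seq; apply: lee_sum => J JD.
  by apply: int_itv; exact/ltW/(tp_nondegenerate tD).
move: H2 H1 Fm Hnm; rewrite /riemann_sum; set S2 := \sum_(J <- D) _ => H2.
set S1 := \sum_(J <- D) _ => H1; set S3 := \sum_(J <- D) _ => H3.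
set S4 := \sum_(J <- D) _ => H4.
apply: (@le_lt_trans _ _ (S1 + S2 + S3 + S4)); last first.
  have := e_le _ _ nm; rewrite -/(e n) in H2; lra.
rewrite /S1 /S2 /S3 /S4 -!big_split/= big_seq [leRHS]big_seq.
apply: ler_sum => J JD.
have -> : simple_int (diff n m) (co_itv J) =
    (H m (ti_hi J) - H m (ti_lo J)) - (H n (ti_hi J) - H n (ti_lo J)).
  have lh := ltW (tp_nondegenerate tD JD).
  by rewrite simple_int_diff /H !simple_primB.
have -> : rho (f (ti_tag J) - simple_fun (s n) (val (ti_tag J))) * ti_len J =
    rho (ti_len J *: simple_fun (s n) (val (ti_tag J)) - ti_len J *: f (ti_tag J)).
  rewrite -scalerBr (seminormZ rhoP) mulrC (seminormBC rhoP) ger0_norm//.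
  exact/ltW/(ti_len_gt0 tD).
set y := _ *: simple_fun _ _; set x := _ *: f _.
set Fh := F (ti_hi J); set Fl := F (ti_lo J).
rewrite -/(H n); set mh := H m (ti_hi J); set ml := H m (ti_lo J).
set dn := H n (ti_hi J) - H n (ti_lo J).
have : rho (Fh - Fl - (mh - ml)) <= rho (mh - Fh) + rho (ml - Fl).
  have -> : Fh - Fl - (mh - ml) = (Fh - mh) + (ml - Fl).
    by rewrite opprB addrACA [- Fl + _]addrC addrACA [ml - Fl]addrC addrACA.
  by rewrite (seminormBC rhoP mh) (seminormD rhoP).
have := seminorm_triangle rhoP (mh - ml) (Fh - Fl) x.
have := seminorm_triangle rhoP dn (mh - ml) x.
have := seminorm_triangle rhoP y dn x.
lra.
Qed.

End SKHPrimitive.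

(** * Functions approximable by simple functions *)

Section KHClosure.
Context {R : realType} {a b : R}.
Hypothesis ab : a < b.
Implicit Types (g h : seg a b -> R).
Local Notation mu := (@lebesgue_measure R).

Lemma conull_segment : @conull R a b `[a, b]%classic.
Proof.
by split; [exact: measurable_segment|exact: subset_refl|rewrite setDv measure0].
Qed.

Lemma integral_cst_segment (c : R) :
  (\int[mu]_(x in `[a, b]) c%:E = (c * (b - a))%:E)%E.
Proof.
rewrite integral_cst// EFinM; congr (_ * _)%E.
exact: (measure_conull ab conull_segment).
Qed.

Lemma upper_sums_le_cst c e : 0 <= c -> c * (b - a) < e ->
  upper_sums_le (fun _ : seg a b => c) e.
Proof.
move=> c0 ce.
apply: (@upper_sums_le_integral _ _ _ _ `[a, b]%classic (fun=> c)) => //.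
  exact: conull_segment.
by rewrite integral_cst_segment lte_fin.
Qed.

Lemma upper_sums_ge0 g e : (forall t, 0 <= g t) -> upper_sums_le g e -> 0 <= e.
Proof.
move=> g0 [d dg De]; have [D fD] := exists_fine_partition ab dg.
exact: le_trans (riemann_sum_ge0 fD.1 g0) (De _ fD).
Qed.

(** The value of the integral is known in advance as the infimum of the upper bounds. Sums of [g]
    cannot exceed it by much for a suitable gauge, and a nearby integrable [h] confines them to a
    short interval, so they cannot fall far below it either. *)
Lemma KH_integrable_closed g K : (forall t, 0 <= g t) -> upper_sums_le g K ->
  (forall e : R, 0 < e -> exists2 h, KH_integrable h &
    upper_sums_le (fun t => `|g t - h t|) e) ->
  KH_integrable g.
Proof.
move=> g0 gK approx.
pose U := [set r : R | upper_sums_le g r].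
have hU : has_inf U by split; [exists K|exists 0 => r; exact: upper_sums_ge0].
exists (inf U) => e e0.
have [|h [z hz] [d1 d1g D1]] := approx (e / 6); first by rewrite divr_gt0.
have [|d2 d2g D2] := hz (e / 6); first by rewrite divr_gt0.
have [|r [d3 d3g D3] rz] := @inf_adherent _ U (e / 6) _ hU; first by rewrite divr_gt0.
have dist D : fine_partition (fun t => Num.min (d1 t) (d2 t)) D ->
    `|riemann_sum g D - z| <= e / 3.
  move=> /fine_partition_min[fD /D2 hD].
  have := D1 _ fD; have : `|riemann_sum g D - riemann_sum h D| <=
      riemann_sum (fun t => `|g t - h t|) D.
    rewrite /riemann_sum -sumrB; apply: (le_trans (ler_norm_sum _ _ _)).
    rewrite big_seq [leRHS]big_seq; apply: ler_sum => J JD.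
    by rewrite -mulrBl normrM [`|ti_len J|]ger0_norm// ltW// (ti_len_gt0 fD.1).
  move: hD; rewrite -/(riemann_sum h D) !ltr_norml !ler_norml.
  by move=> /andP[? ?] /andP[? ?] ?; apply/andP; split; lra.
have zU : inf U <= z + e / 3.
  apply: ge_inf; first exact: hU.2.
  exists (fun t => Num.min (d1 t) (d2 t)); first exact: is_gauge_min.
  by move=> D /dist; rewrite ler_norml => /andP[? ?]; lra.
exists (fun t => Num.min (Num.min (d1 t) (d2 t)) (d3 t)).
  by apply: is_gauge_min => //; exact: is_gauge_min.
move=> D /fine_partition_min[/dist gz /D3 gr]; rewrite -/(riemann_sum g D).
by move: gz; rewrite ler_norml ltr_norml => /andP[? ?]; apply/andP; split; lra.
Qed.

Lemma KH_integrable_upper_sums g : KH_integrable g -> exists K, upper_sums_le g K.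
Proof.
move=> [z gz]; have [//|d dg D1] := gz 1; exists (z + 1); exists d => // D /D1.
by rewrite -/(riemann_sum g D) ltr_norml => /andP[_]; rewrite ltrBlDl => /ltW.
Qed.

End KHClosure.

(** * The closure of the simple functions in p-mean *)

Section Approximable.
Context {R : realType} {X : lmodType R} {a b : R}.
Variables (rho : X -> R) (p : R).
Hypotheses (rhoP : seminorm rho) (ab : a < b) (p1 : 1 <= p).
Local Notation mu := (@lebesgue_measure R).
Implicit Types (f g : seg a b -> X) (s : seq (set R * X)).

Definition approximable f := forall e : R, 0 < e -> exists2 s, simple_measurable s &
  upper_sums_le (fun t => rho (f t - simple_fun s (val t)) `^ p) e.

Let p0 : 0 <= p. Proof. exact: le_trans ler01 p1. Qed.

Let powD_rho (u v : X) : rho (u + v) `^ p <= 2 `^ p * (rho u `^ p + rho v `^ p).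
Proof.
apply: le_trans (powRD_le p0 (seminorm_ge0 rhoP _) (seminorm_ge0 rhoP _)).
by apply: powR_le; rewrite ?seminorm_ge0// seminormD.
Qed.

(** The level [r] is fixed first, to make the constant term small; [s] is then chosen close enough
    to beat the factor that [r] produces. *)
Lemma approximable_SKH f : sequentially_complete rho -> approximable f ->
  SKH_integrable rho f.
Proof.
move=> complete fa; apply: SKH_limit => // e e0.
have ba0 : 0 < b - a + 1 by move: ab; lra.
pose r := e / 2 / (b - a + 1); have r0 : 0 < r by rewrite !divr_gt0.
have rp : 0 < r `^ (1 - p) by rewrite powR_gt0.
have [|s ms se] := fa (e / 2 / r `^ (1 - p)); first by rewrite !divr_gt0.
exists s => //.
have rab : r * (b - a) < e / 2.
  by rewrite -(ltr_pM2r ba0) {1}/r mulrAC divfK ?gt_eqF// ltr_pM2l ?divr_gt0//; lra.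
have := upper_sums_leD (upper_sums_le_cst ab (ltW r0) rab) (upper_sums_leZ (ltW rp) se).
apply: upper_sums_leW; last by rewrite [_ `^ _ * _]mulrC divfK ?gt_eqF//; lra.
by move=> t; apply: le_addM_powR => //; exact: seminorm_ge0.
Qed.

Lemma KH_integrable_simple s : simple_measurable s ->
  KH_integrable (fun t : seg a b => rho (simple_fun s (val t)) `^ p).
Proof.
move=> ms; have [M M0 HM] := simple_fun_bounded rhoP s.
have mrho : measurable_fun `[a, b] (fun x => rho (simple_fun s x) `^ p).
  apply: (measurableT_comp (measurable_powR p)).
  exact: measurable_seminorm_simple0.
apply: (@KH_integrable_lebesgue _ _ _ ab _ `[a, b]%classic
  (fun x => rho (simple_fun s x) `^ p)) => //.
- exact: conull_segment.
- by move=> t; exact: powR_ge0.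
apply: (@le_lt_trans _ _ (\int[mu]_(x in `[a, b]) (M `^ p)%:E)%E).
  apply: ge0_le_integral => //=.
  - by move=> x _; rewrite lee_fin powR_ge0.
  - exact/measurable_EFinP.
  - by move=> x _; rewrite lee_fin powR_le// seminorm_ge0.
by rewrite (integral_cst_segment ab) ltry.
Qed.

Lemma approximable_bounded f : approximable f ->
  exists K, upper_sums_le (fun t => rho (f t) `^ p) K.
Proof.
move=> fa; have [s ms sf] := fa _ ltr01.
have [K sK] := KH_integrable_upper_sums (KH_integrable_simple ms).
exists (2 `^ p * (1 + K)).
apply: upper_sums_leW (lexx _) (upper_sums_leZ (powR_ge0 2 p) (upper_sums_leD sf sK)).
by move=> t; apply: le_trans (powD_rho _ _); rewrite subrK.
Qed.

Lemma approximable_KH f : approximable f -> KH_integrable (fun t => rho (f t) `^ p).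
Proof.
move=> fa; have [K fK] := approximable_bounded fa.
apply: (KH_integrable_closed ab _ fK); first by move=> t; exact: powR_ge0.
move=> e e0; have K0 : 0 <= K.
  by apply: upper_sums_ge0 fK => // t; exact: powR_ge0.
have K10 : 0 < K + 1 by lra.
(* The small weight falls on the power of [rho (f t)], whose bound [K] does not depend on [s]; the
   possibly large [C] multiplies the approximation error, chosen afterwards. *)
have [|C C0 HC] := @powR_dist_le _ p (e / 2 / (K + 1)) p1; first by rewrite !divr_gt0.
have C10 : 0 < C + 1 by lra.
have [|s ms sf] := fa (e / 2 / (C + 1)); first by rewrite !divr_gt0.
exists (fun t => rho (simple_fun s (val t)) `^ p); first exact: KH_integrable_simple.
have eK : 0 <= e / 2 / (K + 1) by rewrite !divr_ge0 ?ltW.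
apply: upper_sums_leW (upper_sums_leD (upper_sums_leZ eK fK) (upper_sums_leZ C0 sf)).
  by move=> t; apply: HC; rewrite ?seminorm_ge0// seminorm_dist.
have : e / 2 / (K + 1) * K <= e / 2.
  by rewrite mulrAC ler_pdivrMr// ler_pM2l ?divr_gt0//; lra.
have : C * (e / 2 / (C + 1)) <= e / 2.
  by rewrite mulrA ler_pdivrMr// mulrC ler_pM2l ?divr_gt0//; lra.
lra.
Qed.

Lemma approximable_lin c f g : approximable f -> approximable g ->
  approximable (fun t => c *: f t + g t).
Proof.
move=> fa ga e e0; pose C := 2 `^ p * (`|c| `^ p + 1).
have C0 : 0 < C by rewrite mulr_gt0 ?powR_gt0 ?ltr_wpDl ?powR_ge0.
have eC : 0 < e / C by rewrite divr_gt0.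
have CK : e / C * C = e by rewrite divfK// gt_eqF.
have [s ms sf] := fa _ eC; have [s' ms' sg] := ga _ eC.
exists (simple_scale c s ++ s').
  by apply: simple_measurable_cat => //; exact: simple_measurable_scale.
have := upper_sums_leZ (powR_ge0 2 p)
  (upper_sums_leD (upper_sums_leZ (powR_ge0 `|c| p) sf) sg).
apply: upper_sums_leW; last first.
  by rewrite -[leRHS]CK /C; move: (e / _) => q; lra.
move=> t; rewrite simple_fun_cat simple_fun_scale opprD addrACA -scalerBr.
rewrite (le_trans (powD_rho _ _))// (seminormZ rhoP) powRM//.
exact: seminorm_ge0.
Qed.

Lemma approximable_closed f : (forall e : R, 0 < e -> exists2 g, approximable g &
    upper_sums_le (fun t => rho (g t - f t) `^ p) e) -> approximable f.
Proof.
move=> fa e e0; pose C : R := 2 `^ p * 2.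
have C0 : 0 < C by rewrite mulr_gt0 ?powR_gt0.
have eC : 0 < e / C by rewrite divr_gt0.
have CK : e / C * C = e by rewrite divfK// gt_eqF.
have [g ga gf] := fa _ eC; have [s ms sg] := ga _ eC; exists s => //.
have := upper_sums_leZ (powR_ge0 2 p) (upper_sums_leD gf sg).
apply: upper_sums_leW; last first.
  by rewrite -[leRHS]CK /C; move: (e / _) => q; lra.
move=> t; rewrite (seminormBC rhoP (g t)).
by apply: le_trans (powD_rho _ _); rewrite addrA subrK.
Qed.

End Approximable.

(** * Bisection and almost everywhere convergence of difference quotients *)

Section Bisection.
Context {R : realType} {X : lmodType R} {a b : R}.
Variable rho : X -> R.
Hypothesis rhoP : seminorm rho.
Local Notation mu := (@lebesgue_measure R).
Variables (f F : seg a b -> X).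
Implicit Types (u v t : seg a b) (delta : seg a b -> R) (eta : R).

Lemma mid_subproof u v : (val u + val v) / 2 \in `[a, b].
Proof.
have := seg_itv u; have := seg_itv v; rewrite in_itv /=.
by move=> /andP[? ?] /andP[? ?]; apply/andP; split; lra.
Qed.

Definition mid u v : seg a b :=
  exist (fun x : R => x \in `[a, b]) _ (mid_subproof u v).

Lemma val_mid u v : val (mid u v) = (val u + val v) / 2.
Proof. by []. Qed.

Lemma lt_mid u v : val u < val v -> val u < val (mid u v) < val v.
Proof. by rewrite val_mid => ?; apply/andP; split; lra. Qed.

(** The bound on the length makes [(u, v, t)] fine at its tag; the last condition says that the
    difference quotient of [F] misses [f t] by more than [eta]. *)
Definition bad_itv delta eta u v : Prop := exists t,
  [/\ val u <= val t <= val v, val v - val u < delta t &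
    eta * (val v - val u) < rho (F v - F u - (val v - val u) *: f t)].

Fixpoint bad_set delta eta n u v : set R :=
  if `[< bad_itv delta eta u v >] then `[val u, val v[%classic
  else if n is n'.+1
    then bad_set delta eta n' u (mid u v) `|` bad_set delta eta n' (mid u v) v
    else set0.

Lemma measurable_bad_set delta eta n u v : measurable (bad_set delta eta n u v).
Proof.
elim: n u v => [|n IH] u v /=; case: asboolP => _; try exact: measurable_itv.
  exact: measurable0.
exact: measurableU.
Qed.

Lemma bad_set_nondecreasing delta eta u v :
  nondecreasing_seq (fun n => bad_set delta eta n u v).
Proof.
apply/nondecreasing_seqP => n; apply/subsetPset; elim: n u v => [|n IH] u v.
  by rewrite /=; case: asboolP => _; [exact: subset_refl|exact: sub0set].
rewrite [bad_set _ _ n.+1 u v]/= [bad_set _ _ n.+2 u v]/=; case: asboolP => _.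
  exact: subset_refl.
by apply: setUSS; [exact: (IH u (mid u v))|exact: (IH (mid u v) v)].
Qed.

(** The bad intervals, with their witnesses as tags, are members of a fine partition completed by
    Cousin's lemma, and each contributes more than [eta] times its length to the SKH sum. *)
Lemma bad_set_partition delta eta n u v : is_gauge delta -> 0 <= eta ->
  val u < val v -> exists2 D, fine_partition_of delta (val u) (val v) D &
  (eta%:E * mu (bad_set delta eta n u v) <= (\sum_(J <- D)
    rho (F (ti_hi J) - F (ti_lo J) - ti_len J *: f (ti_tag J)))%:E)%E.
Proof.
move=> dg eta0; have base w z : val w < val z -> bad_itv delta eta w z ->
    exists2 D, fine_partition_of delta (val w) (val z) D &
    (eta%:E * mu `[val w, val z[%classic <= (\sum_(J <- D)
      rho (F (ti_hi J) - F (ti_lo J) - ti_len J *: f (ti_tag J)))%:E)%E.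
  move=> wz [t [/andP[wt tz] ltd big]]; exists [:: (w, z, t)].
    by apply: fine_partition_of1 => //; lra.
  rewrite big_seq1 lebesgue_measure_itv/= lte_fin wz -EFinB -EFinM lee_fin.
  exact: ltW.
elim: n u v => [|n IH] u v uv /=; case: asboolP => [/(base _ _ uv)//|_].
  have [D DP] := cousin dg uv; exists D => //.
  by rewrite measure0 mule0 lee_fin sumr_ge0// => J _; exact: seminorm_ge0.
have /andP[um mv] := lt_mid uv.
have [D1 P1 H1] := IH _ _ um; have [D2 P2 H2] := IH _ _ mv.
exists (D1 ++ D2).
  exact: (fine_partition_of_cat (ltW um) (ltW mv) P1 P2).
rewrite big_cat EFinD; apply: le_trans (leeD H1 H2).
rewrite -ge0_muleDr// lee_wpmul2l ?lee_fin//.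
by apply: (measureU2 mu); exact: measurable_bad_set.
Qed.

Fixpoint diff_quotient n u v : seq (set R * X) :=
  if n is n'.+1 then diff_quotient n' u (mid u v) ++ diff_quotient n' (mid u v) v
  else [:: (`[val u, val v[%classic, (val v - val u)^-1 *: (F v - F u))].

Lemma simple_measurable_diff_quotient n u v : simple_measurable (diff_quotient n u v).
Proof.
elim: n u v => [|n IH] u v; last exact: simple_measurable_cat.
by move=> c; rewrite inE => /eqP->; exact: measurable_itv.
Qed.

Lemma diff_quotient_out n u v x : val u <= val v -> ~ (val u <= x < val v) ->
  simple_fun (diff_quotient n u v) x = 0.
Proof.
elim: n u v => [|n IH] u v uv xuv.
  by rewrite simple_fun_cons memNset ?add0r /simple_fun ?big_nil//= in_itv.
have um : val u <= val (mid u v) by rewrite val_mid; lra.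
have mv : val (mid u v) <= val v by rewrite val_mid; lra.
rewrite /= simple_fun_cat !IH ?addr0// => /andP[x1 x2]; apply: xuv.
  by rewrite x2 (le_trans um).
by rewrite x1 (lt_le_trans x2).
Qed.

(** Bisection leads to the interval of depth [n] containing [t]. It is not bad, [t] being outside
    the bad set, and it is shorter than [delta t]; so [t] cannot witness a large error. *)
Lemma diff_quotient_close delta eta n u v t : val u <= val t < val v ->
  ~ bad_set delta eta n u v (val t) -> val v - val u < 2 ^+ n * delta t ->
  rho (simple_fun (diff_quotient n u v) (val t) - f t) <= eta.
Proof.
elim: n u v => [|n IH] u v /andP[ut tv]; have uv := le_lt_trans ut tv.
  rewrite /= expr0 mul1r; case: asboolP => [_ []|nb _ vud].
    by rewrite /= in_itv /= ut tv.
  rewrite simple_fun_cons mem_set/= ?in_itv/= ?ut// /simple_fun big_nil addr0.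
  have vu0 : 0 < val v - val u by rewrite subr_gt0.
  have : ~ (eta * (val v - val u) < rho (F v - F u - (val v - val u) *: f t)).
    by move=> big; apply: nb; exists t; split; rewrite ?ut ?(ltW tv).
  move/negP; rewrite -leNgt.
  rewrite -{1}[F v - F u]scale1r -[1](divff (lt0r_neq0 vu0)) -scalerA -scalerBr.
  by rewrite (seminormZ rhoP) gtr0_norm// mulrC ler_pM2r.
have /andP[um mv] := lt_mid uv.
move=> + vud; rewrite /=; case: asboolP => [_ []|nb nW]; first by rewrite /= in_itv /= ut tv.
have half : (val v - val u) / 2 < 2 ^+ n * delta t by rewrite exprS in vud; lra.
rewrite simple_fun_cat; have [tm|mt] := ltP (val t) (val (mid u v)).
  rewrite (diff_quotient_out _ (ltW mv)) ?addr0; last first.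
    by move=> /andP[mt _]; have := lt_le_trans tm mt; rewrite ltxx.
  apply: IH; [by rewrite ut|by move=> W; apply: nW; left|rewrite val_mid; lra].
rewrite (diff_quotient_out _ (ltW um)) ?add0r; last first.
  by move=> /andP[_ tm]; have := lt_le_trans tm mt; rewrite ltxx.
apply: IH; [by rewrite mt|by move=> W; apply: nW; right|rewrite val_mid; lra].
Qed.

Hypothesis ab : a < b.

Let aab : a \in `[a, b]. Proof. by rewrite in_itv /= lexx ltW. Qed.
Let bab : b \in `[a, b]. Proof. by rewrite in_itv /= lexx ltW. Qed.
Let sa : seg a b := exist _ a aab.
Let sb : seg a b := exist _ b bab.

(** For each tolerance [e k] there are gauges whose bad sets, joined over all depths, are as small
    as desired. A point off one of them has quotients within [e k] of [f] from some depth on, so the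
    exceptional points for [e k] form a null set. *)
Lemma SKH_primitive_cvg_ae : SKH_primitive rho f F ->
  exists (D : set R) (s : nat -> seq (set R * X)),
  [/\ conull (a:=a) (b:=b) D, forall n, simple_measurable (s n) &
    forall t : seg a b, D (val t) -> forall eta, 0 < eta -> exists n0, forall n,
      (n0 <= n)%N -> rho (simple_fun (s n) (val t) - f t) <= eta].
Proof.
move=> fF; pose e (k : nat) : R := k.+1%:R^-1.
have e0 k : 0 < e k by rewrite invr_gt0.
(* An SKH error below [e k * e j], divided by the tolerance [e k], leaves measure at most [e j],
   uniformly in the depth. *)
have /choice[d dP] : forall kj : nat * nat, exists d : seg a b -> R, is_gauge d /\
    forall n, (mu (bad_set d (e kj.1) n sa sb) <= (e kj.2)%:E)%E.
  move=> [k j] /=; have [|d dg Dd] := fF (e k * e j); first by rewrite mulr_gt0.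
  exists d; split => // n.
  have [D /fine_partition_of_total/Dd De le1] := 
    @bad_set_partition d (e k) n sa sb dg (ltW (e0 k)) ab.
  by rewrite -(@lee_pmul2l _ (e k)%:E)// ?lte_fin// -EFinM (le_trans le1)// lee_fin ltW.
pose B k j := \bigcup_n bad_set (d (k, j)) (e k) n sa sb.
have mB k j : measurable (B k j).
  by apply: bigcupT_measurable => n; exact: measurable_bad_set.
have Bj k j : (mu (B k j) <= (e j)%:E)%E.
  have [_ muB] := dP (k, j).
  have := @nondecreasing_cvg_mu _ _ _ mu _ (fun n => measurable_bad_set _ _ n sa sb) (mB k j)
    (@bad_set_nondecreasing (d (k, j)) (e k) sa sb).
  move=> cv; rewrite -(cvg_lim _ cv)//; apply: lime_le.
    by apply/cvg_ex; eexists; exact: cv.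
  exact: nearW.
(* The point [b] belongs to no half-open bisection interval. *)
pose N := [set b] `|` \bigcup_k \bigcap_j B k j.
have mNk k : measurable (\bigcap_j B k j) by exact: bigcapT_measurable.
have mN : measurable N by apply: measurableU => //; exact: bigcupT_measurable.
have Nk0 k : mu (\bigcap_j B k j) = 0%E.
  apply/eqP; rewrite eq_le measure_ge0 andbT; apply/lee_addgt0Pr => r r0.
  rewrite add0e; pose j := Num.truncn r^-1.
  apply: (@le_trans _ _ (mu (B k j))).
    by apply: le_measure; rewrite ?inE; [exact: mNk|exact: mB|move=> x Bx; exact: Bx].
  rewrite (le_trans (Bj k j))// lee_fin /e invf_ple ?posrE//.
  exact/ltW/truncnS_gt.
have N0 : mu N = 0%E.
  apply/negligibleP => //; apply: negligibleU.
    by apply/negligibleP; [exact: measurable_set1|exact: lebesgue_measure_set1].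
  by apply: negligible_bigcup => k; exists (\bigcap_j B k j); split;
    [exact: mNk|exact: Nk0|exact: subset_refl].
exists (`[a, b]%classic `\` N), (fun n => diff_quotient n sa sb); split.
- split; [exact: measurableD|exact: subDsetl|].
  apply/eqP; rewrite eq_le measure_ge0 andbT -N0; apply: le_measure; rewrite ?inE//.
  + by do 2 apply: measurableD => //.
  + by move=> x [x1 x2]; apply: contrapT => Nx; apply: x2.
- by move=> n; exact: simple_measurable_diff_quotient.
move=> t [_ Nt] eta eta0.
have tb : val t < b.
  have /andP[_] := seg_itv t; rewrite le_eqVlt => /predU1P[tb|//].
  by case: Nt; left.
pose k := Num.truncn eta^-1.
have [j nBj] : exists j, ~ B k j (val t).
  by apply/existsNP => Bk; apply: Nt; right; exists k => // j _; exact: Bk.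
have [dg _] := dP (k, j).
pose n0 := (Num.truncn ((b - a) / d (k, j) t)).+1.
exists n0 => n nn.
apply: (@le_trans _ _ (e k)).
  apply: (@diff_quotient_close (d (k, j))).
  - by rewrite /= tb; have /andP[-> _] := seg_itv t.
  - by move=> W; apply: nBj; exists n.
  - rewrite /= -ltr_pdivrMr//; apply: (lt_le_trans (truncnS_gt _)).
    apply: (@le_trans _ _ n%:R); first by rewrite ler_nat.
    by rewrite -natrX ler_nat ltnW// ltn_expl.
by rewrite /e invf_ple ?posrE//; exact/ltW/truncnS_gt.
Qed.

End Bisection.

(** * Approximation in mean *)

Section Truncation.
Context {R : realType} {X : lmodType R}.
Variable rho : X -> R.
Hypothesis rhoP : seminorm rho.
Implicit Types s : seq (set R * X).

(** Values of seminorm above [m] are replaced by 0 instead of being rescaled, so the result is again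
    a list with the same vectors. *)
Definition simple_trunc (m : R) s :=
  [seq (c.1 `&` [set x | rho (simple_fun s x) <= m], c.2) | c <- s].

Lemma simple_measurable_trunc m s : simple_measurable s ->
  simple_measurable (simple_trunc m s).
Proof.
move=> ms _ /mapP[c cs ->] /=; apply: measurableI; first exact: ms.
have := @measurable_seminorm_simple0 _ _ rho s setT ms.
move=> /(_ measurableT `]-oo, m]%classic (measurable_itv _)); rewrite setTI.
by congr measurable; apply/seteqP; split => x /=; rewrite in_itv.
Qed.

Lemma simple_fun_trunc m s x : simple_fun (simple_trunc m s) x =
  if rho (simple_fun s x) <= m then simple_fun s x else 0.
Proof.
rewrite /simple_fun big_map -/(simple_fun s x); case: ifPn => xm.
  by apply: eq_bigr => c _ /=; rewrite indicI /= [\1_[set _ | _] x]indicE mem_set// mulr1.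
by rewrite big1// => c _ /=; rewrite indicI /= [\1_[set _ | _] x]indicE memNset
  ?mulr0 ?scale0r//; exact/negP.
Qed.

Lemma seminorm_simple_trunc_le m s x : 0 <= m ->
  rho (simple_fun (simple_trunc m s) x) <= m.
Proof. by move=> m0; rewrite simple_fun_trunc; case: ifPn; rewrite ?(seminorm0 rhoP). Qed.

End Truncation.

Lemma powR_small (R : realType) (p e : R) : 0 < p -> 0 < e ->
  exists2 d : R, 0 < d & forall x, 0 <= x -> x <= d -> x `^ p <= e.
Proof.
move=> p0 e0; exists (e `^ p^-1); first by rewrite powR_gt0.
move=> x x0 xd; apply: (le_trans (powR_le (ltW p0) x0 xd)).
by rewrite -powRrM mulVf ?gt_eqF// powRr1// ltW.
Qed.

Lemma dominated_integral_small (R : realType) (D : set R) (h : nat -> R -> R)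
    (g : R -> R) (e : R) :
  measurable D -> (forall n, measurable_fun D (h n)) -> measurable_fun D g ->
  (forall n x, D x -> 0 <= h n x <= g x) ->
  (\int[@lebesgue_measure R]_(x in D) (g x)%:E < +oo)%E ->
  (forall x, D x -> forall r : R, 0 < r -> exists N, forall n, (N <= n)%N -> h n x <= r) ->
  0 < e -> exists n, (\int[@lebesgue_measure R]_(x in D) (h n x)%:E < e%:E)%E.
Proof.
move=> mD mh mg hg goo h0 e0.
have g0 x : D x -> 0 <= g x.
  by move=> Dx; have /andP[h1 h2] := hg 0%N x Dx; exact: le_trans h2.
have ig : (@lebesgue_measure R).-integrable D (EFin \o g).
  apply/integrableP; split; first exact/measurable_EFinP.
  apply: le_lt_trans goo; rewrite le_eqVlt; apply/orP; left; apply/eqP.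
  by apply: eq_integral => x; rewrite inE => Dx; rewrite /= ger0_norm// g0.
have hcv x : D x -> (fun n => (h n x)%:E) @ \oo --> 0%E.
  move=> Dx; apply/fine_cvgP; split; first exact: nearW.
  apply/cvgrPdist_le => r r0; have [N HN] := h0 x Dx r r0.
  exists N => // n /= Nn; rewrite sub0r normrN ger0_norm ?HN//.
  by have /andP[] := hg n x Dx.
have hb x n : D x -> (`|(h n x)%:E| <= (EFin \o g) x)%E.
  by move=> Dx; have /andP[h1 h2] := hg n x Dx; rewrite /= lee_fin ger0_norm.
have [_ _] := @dominated_convergence _ _ _ (@lebesgue_measure R) D mD
  (fun n x => (h n x)%:E) (fun=> 0%E) (EFin \o g)
  (fun n => (measurable_EFinP _ _).2 (mh n)) (measurable_cst _)
  (aeW (@lebesgue_measure R) hcv) ig (aeW (@lebesgue_measure R) hb).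
rewrite integral0 => cv.
apply/not_existsP => hne.
have : (e%:E <= 0)%E.
  rewrite -(cvg_lim _ cv)//; apply: lime_ge; first by apply/cvg_ex; eexists; exact: cv.
  by apply: nearW => n; rewrite leNgt; apply/negP; exact: hne.
by rewrite lee_fin leNgt e0.
Qed.

(** * From almost everywhere convergence to p-mean approximation *)

Section AeApproximable.
Context {R : realType} {X : lmodType R} {a b : R}.
Variables (rho : X -> R) (p : R).
Hypotheses (rhoP : seminorm rho) (ab : a < b) (p1 : 1 <= p).
Local Notation mu := (@lebesgue_measure R).

(** The error is split according to whether [phi], the seminorm of [f], is below [m]. The tail is
    dominated by a multiple of [phi] and made small by [m] alone; below [m] the truncated functions
    are bounded and converge. *)
Lemma approximable_ae (f : seg a b -> X) (s : nat -> seq (set R * X)) (D : set R) :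
  conull (a:=a) (b:=b) D -> (forall n, simple_measurable (s n)) ->
  (forall t : seg a b, D (val t) -> forall r : R, 0 < r -> exists N, forall n,
    (N <= n)%N -> rho (simple_fun (s n) (val t) - f t) <= r) ->
  KH_integrable (fun t => rho (f t) `^ p) -> approximable rho p f.
Proof.
move=> cD ms sf fKH e e0; have [mD Dab D0] := cD.
have p0 : 0 < p by exact: lt_le_trans p1.
pose fR (x : R) : X :=
  if pselect (x \in `[a, b]) is left xab then f (exist _ x xab) else 0.
have fRE t : fR (val t) = f t.
  rewrite /fR; case: pselect => [xab|]; last by have := valP t.
  by congr f; apply: val_inj.
have cvgD x : D x -> forall r : R, 0 < r -> exists N, forall n,
    (N <= n)%N -> rho (simple_fun (s n) x - fR x) <= r.
  move=> Dx; have xab : x \in `[a, b] := Dab _ Dx.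
  have := sf (exist _ x xab) Dx; rewrite -fRE; exact.
have mdist s' : simple_measurable s' ->
    measurable_fun D (fun x => rho (fR x - simple_fun s' x)).
  (* Measurability is inherited from the pointwise limit of the seminorms of simple functions. *)
  move=> ms'; apply: (@measurable_fun_cvg _ _ _ _
    (fun n x => rho (simple_fun (s n ++ simple_scale (-1) s') x))).
    move=> n; apply: measurable_seminorm_simple0.
    by apply: simple_measurable_cat => //; exact: simple_measurable_scale.
  move=> x Dx; apply/cvgrPdist_le => r r0; have [N HN] := cvgD x Dx r r0.
  exists N => // n /= /HN; apply: le_trans.
  rewrite simple_fun_cat simple_fun_scale scaleN1r.
  rewrite (le_trans (seminorm_dist rhoP _ _))// (seminormBC rhoP (simple_fun _ _)).
  by rewrite opprB addrA subrK.
pose phi x := rho (fR x).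
have mphi : measurable_fun D phi.
  have m0 : simple_measurable ([::] : seq (set R * X)) by [].
  have -> : phi = (fun x => rho (fR x - simple_fun [::] x)).
    by apply/funext => x; rewrite /simple_fun big_nil subr0.
  exact: mdist.
have phi0 x : 0 <= phi x by exact: (seminorm_ge0 rhoP).
have mpowR (h : R -> R) : measurable_fun D h -> measurable_fun D (fun x => h x `^ p).
  by move=> mh; exact: (measurableT_comp (measurable_powR p)).
have [K fK] := KH_integrable_upper_sums fKH.
(* Kurzweil-Henstock integrability enters here: bounded upper sums and the measurability of [phi]
   make its p-th power Lebesgue integrable. *)
have phioo : (\int[mu]_(x in D) (phi x `^ p)%:E <= K%:E)%E.
  apply: (integral_le_upper_sums ab cD _ _ _ _ fK).
  - by move=> t; exact: powR_ge0.
  - exact: mpowR.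
  - by move=> x _; exact: powR_ge0.
  - by move=> t _; rewrite /phi fRE.
have mcond m : measurable_fun D (fun x => phi x < m).
  by apply: measurable_fun_ltr => //; exact: measurable_cst.
have m2phi : measurable_fun D (fun x => (2 * phi x) `^ p).
  by apply: mpowR; apply: measurable_funM => //; exact: measurable_cst.
(* Where [phi x >= m], the distance from [f] to a function of seminorm at most [m] is at most
   [phi x + m <= 2 * phi x], whatever [n]; so [m] can be fixed before [n]. *)
pose tail m x := if phi x < m%:R then 0 else (2 * phi x) `^ p.
have mtail m : measurable_fun D (tail m).
  apply: (measurable_fun_if mD (mcond m%:R)); first exact: measurable_cst.
  by apply: measurable_funS m2phi => // x [].
have tail_le m x : D x -> 0 <= tail m x <= (2 * phi x) `^ p.
  by rewrite /tail; case: ifP; rewrite ?lexx powR_ge0.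
have tail_cvg x : D x -> forall r : R, 0 < r -> exists N, forall n,
    (N <= n)%N -> tail n x <= r.
  move=> _ r r0; exists (Num.truncn (phi x)).+1 => n Nn; rewrite /tail.
  have -> : phi x < n%:R by apply: (lt_le_trans (truncnS_gt _)); rewrite ler_nat.
  exact: ltW.
have tail_oo : (\int[mu]_(x in D) ((2 * phi x) `^ p)%:E < +oo)%E.
  under eq_integral => x _ do rewrite powRM// EFinM.
  rewrite ge0_integralZl ?lee_fin ?powR_ge0//; last 2 first.
  - by apply/measurable_EFinP; exact: mpowR.
  - by move=> x _; rewrite lee_fin powR_ge0.
  apply: (@le_lt_trans _ _ ((2 `^ p)%:E * K%:E)%E); last by rewrite -EFinM ltry.
  by rewrite lee_wpmul2l ?lee_fin ?powR_ge0.
have e20 : 0 < e / 2 by rewrite divr_gt0.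
have [m tail_e] := dominated_integral_small mD mtail m2phi tail_le tail_oo tail_cvg e20.
pose sm n := simple_trunc rho m%:R (s n).
have msm n : simple_measurable (sm n) by exact: simple_measurable_trunc.
pose body n x := if phi x < m%:R then rho (fR x - simple_fun (sm n) x) `^ p else 0.
have mbody n : measurable_fun D (body n).
  apply: (measurable_fun_if mD (mcond m%:R)); last exact: measurable_cst.
  by apply: measurable_funS (mpowR _ (mdist _ (msm n))) => // x [].
have dist_le n x : rho (fR x - simple_fun (sm n) x) <= phi x + m%:R.
  rewrite (le_trans (seminormD rhoP _ _))// (seminormN rhoP) lerD2l.
  by apply: seminorm_simple_trunc_le.
have body_le n x : D x -> 0 <= body n x <= (2 * m%:R) `^ p.
  move=> _; rewrite /body; case: ifPn => [phim|_]; last by rewrite lexx powR_ge0.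
  rewrite powR_ge0 powR_le ?(seminorm_ge0 rhoP) ?(ltW p0)//.
  by rewrite (le_trans (dist_le n x))//; lra.
have body_cvg x : D x -> forall r : R, 0 < r -> exists N, forall n,
    (N <= n)%N -> body n x <= r.
  move=> Dx r r0; rewrite /body; case: (boolP (phi x < m%:R)) => [phim|_]; last first.
    by exists 0%N => n _; exact: ltW.
  have [d d0 dr] := powR_small p0 r0.
  (* The margin [m%:R - phi x] ensures that [s n] has seminorm at most [m] at [x], so the truncation
     leaves it unchanged there. *)
  have [|N HN] := cvgD x Dx (Num.min d ((m%:R - phi x))).
    by rewrite lt_min d0 subr_gt0.
  exists N => n /HN; rewrite le_min => /andP[nd nm]; rewrite simple_fun_trunc.
  have -> : rho (simple_fun (s n) x) <= m%:R.
    rewrite -[simple_fun _ _](subrK (fR x)) (le_trans (seminormD rhoP _ _))//.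
    by move: nm; rewrite /phi lerBrDr.
  by rewrite dr ?(seminorm_ge0 rhoP)// (seminormBC rhoP).
have body_oo : (\int[mu]_(x in D) ((2 * m%:R) `^ p)%:E < +oo)%E.
  rewrite [ltLHS](_ : _ = ((2 * m%:R) `^ p * (b - a))%:E) ?ltry//.
  by rewrite integral_cst// EFinM; congr (_ * _)%E; exact: measure_conull.
have [n body_e] := dominated_integral_small mD mbody (measurable_cst _) body_le
  body_oo body_cvg e20.
exists (sm n) => //.
apply: (@upper_sums_le_integral _ _ _ _ D (fun x => body n x + tail m x)) => //.
- by move=> t; exact: powR_ge0.
- exact: measurable_funD.
- by move=> x Dx; rewrite addr_ge0//;
    [case/andP: (body_le n x Dx)|case/andP: (tail_le m x Dx)].
- move=> t Dt; rewrite -fRE /body /tail; case: ifPn => phim; first by rewrite addr0.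
  rewrite add0r powR_le ?(seminorm_ge0 rhoP) ?(ltW p0)// (le_trans (dist_le n _))//.
  by rewrite -leNgt in phim; lra.
under eq_integral => x _ do rewrite EFinD.
rewrite ge0_integralD//; last 4 first.
- by move=> x Dx; rewrite lee_fin; case/andP: (body_le n x Dx).
- by apply/measurable_EFinP; exact: (mbody n).
- by move=> x Dx; rewrite lee_fin; case/andP: (tail_le m x Dx).
- by apply/measurable_EFinP; exact: (mtail m).
by rewrite (splitr e) EFinD lteD.
Qed.

End AeApproximable.

(** * The space [L_rho] *)

Section LrhoClosed.
Context {R : realType} {X : lmodType R} {a b : R}.
Variables (rho : X -> R) (p : R).
Implicit Types f g : seg a b -> X.

Lemma mu_rho_le f K : upper_sums_le (fun t => rho (f t) `^ p) K ->
  (mu_rho rho p f <= K%:E)%E.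
Proof.
move=> [d dg De]; apply: (@le_trans _ _ (ereal_sup
    [set (\sum_(J <- D) rho (f (ti_tag J)) `^ p * ti_len J)%:E
    | D in fine_partition d])).
  by apply: ereal_inf_lbound; exists d.
by apply: ge_ereal_sup => _ [D /De le1 <-]; rewrite lee_fin.
Qed.

Lemma upper_sums_le_mu_rho f K : (mu_rho rho p f < K%:E)%E ->
  upper_sums_le (fun t => rho (f t) `^ p) K.
Proof.
move=> /ereal_inf_lt[_ [d dg <-] supK]; exists d => // D fD.
rewrite -lee_fin; apply: le_trans (ltW supK).
by apply: ereal_sup_ubound; exists D.
Qed.

Hypothesis p1 : 1 <= p.

Lemma mu_rho_lt_U_norm f (e : R) : 0 < e ->
  (U_norm rho p f < (e `^ p^-1)%:E)%E -> (mu_rho rho p f < e%:E)%E.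
Proof.
move=> e0; have p0 : 0 < p by exact: lt_le_trans p1.
rewrite /U_norm; case: (mu_rho rho p f) => [x| |].
- rewrite poweR_EFin !lte_fin => xe; rewrite ltNge; apply/negP => ex.
  have pV0 : 0 <= p^-1 by rewrite invr_ge0 ltW.
  by have := lt_le_trans xe (powR_le pV0 (ltW e0) ex); rewrite ltxx.
- by rewrite poweRyr ?invr_neq0 ?gt_eqF// ltNge leey.
- by rewrite ltNyr.
Qed.

Hypotheses (rhoP : seminorm rho) (rho_complete : sequentially_complete rho)
  (ab : a < b).

Lemma L_rhoP f : L_rho rho a b p f <-> approximable rho p f.
Proof.
split=> [[[F fF] fKH]|fa]; last first.
  by split; [exact: (approximable_SKH rhoP ab p1 rho_complete fa)|
            exact: (approximable_KH rhoP ab p1 fa)].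
have [D [s [cD ms sf]]] := SKH_primitive_cvg_ae rhoP ab fF.
exact: (approximable_ae rhoP ab p1 cD ms sf fKH).
Qed.

End LrhoClosed.

Theorem theorem10 (R : realType) (X : lmodType R) (rho : X -> R)
    (a b p : R)
    (rho_seminorm : seminorm rho)
    (rho_complete : sequentially_complete rho)
    (ab : a < b) (p1 : 1 <= p) :
  [/\ L_rho rho a b p `<=` U_rho rho a b p,
      GRing.submod_closed [in L_rho rho a b p] &
      closed [set f : U_space rho a b p | L_rho rho a b p (val f)]].
Proof.
have LP := L_rhoP p1 rho_seminorm rho_complete ab.
split.
- move=> f [_ /KH_integrable_upper_sums[K fK]].
  by apply: (le_lt_trans (mu_rho_le fK)); rewrite ltry.
- split.
    rewrite inE; apply/LP => e e0; exists [::] => //.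
    exists (fun=> 1) => // D _; rewrite /riemann_sum big1 ?ltW// => J _.
    rewrite /simple_fun big_nil subr0 (seminorm0 rho_seminorm) powR0 ?mul0r//.
    by rewrite gt_eqF// (lt_le_trans ltr01).
  move=> c f g; rewrite !inE => /LP fa /LP ga; apply/LP.
  exact: approximable_lin.
rewrite -[X in closed X]setCK; apply: open_closedC.
have oE : open (~` [set f : U_space rho a b p | L_rho rho a b p (val f)]) =
  @U_open R X rho a b p (~` [set f : U_space rho a b p | L_rho rho a b p (val f)]).
  by [].
(* If no ball around [f] avoids [L_rho], then [f] is a p-mean limit of its members. *)
rewrite oE => f /= nLf; apply: contrapT => nr; apply: nLf; apply/LP.
apply: (approximable_closed rho_seminorm p1) => e e0.
(* The radius is the p-th root of [e], so that the ball controls [mu_rho] by [e]. *)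
have r0 : 0 < e `^ p^-1 by rewrite powR_gt0.
have [g gf Lg] : exists2 g : U_space rho a b p,
    (U_norm rho p (val g - val f)%R < (e `^ p^-1)%:E)%E & L_rho rho a b p (val g).
  apply: contrapT => ng; apply: nr; exists (e `^ p^-1) => // g gf /= Lg.
  by apply: ng; exists g.
exists (val g); first exact/LP.
by apply: upper_sums_le_mu_rho; exact: mu_rho_lt_U_norm gf.
Qed.
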